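(* Let $\mathbb{F}=\mathbb{R}$ or $\mathbb{C}$, let $0<r<m$ be integers, and let $\mathrm{G}(m,r)$ be the Grassmannian of $r$-dimensional linear subspaces of $\mathbb{F}^m$. For every integer $n$ with $$n>\frac{m^2}{r(m-r)},$$ almost all samples $(U_1,\ldots,U_n)\in\mathrm{G}(m,r)^n$ of size $n$ have a unique Grassmannian maximum likelihood estimate (GE).
   Context: $A^*$ denotes the adjoint (transpose if $\mathbb{F}=\mathbb{R}$, conjugate transpose if $\mathbb{F}=\mathbb{C}$) of a matrix $A$. $\mathrm{Pos}(m)$ is the set of positive definite self-adjoint matrices $\Sigma\in\mathbb{F}^{m\times m}$ with $\det\Sigma=1$. For $\Sigma\in\mathrm{Pos}(m)$, the Grassmannian distribution $\mathcal{G}_\Sigma$ is the law on $\mathrm{G}(m,r)$ of the linear span of $r$ i.i.d. centered normal vectors in $\mathbb{F}^m$ with covariance matrix $\Sigma$ (circularly symmetric if $\mathbb{F}=\mathbb{C}$); $\mathcal{G}_I$ is the uniform distribution. For $U=\langle X\rangle$ the range of a matrix $X\in\mathbb{F}^{m\times r}$ of rank $r$, $$\frac{d\mathcal{G}_\Sigma}{d\mathcal{G}_I}(U)=\left(\frac{\det(X^*X)}{\det(X^*\Sigma^{-1}X)}\right)^{i_{\mathbb{F}}m/2},\qquad i_{\mathbb{F}}=\dim_{\mathbb{R}}\mathbb{F}.$$ A Grassmannian (maximum likelihood) estimate, abbreviated GE, of a sample $U_1,\ldots,U_n$ is a $\Sigma\in\mathrm{Pos}(m)$ that maximizes $\frac1n\sum_{k=1}^n\log\frac{d\mathcal{G}_\Sigma}{d\mathcal{G}_I}(U_k)$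 over $\mathrm{Pos}(m)$; equivalently, it minimizes $\frac1n\sum_{k=1}^n\ell_{U_k}(\Sigma)$ over $\mathrm{Pos}(m)$, where $\ell_U(\Sigma)=\frac12\log\frac{\det(X^*\Sigma^{-1}X)}{\det(X^*X)}$ for $U=\langle X\rangle$. ''Has a unique GE'' means that exactly one GE exists. ''Almost all samples of size $n$'' means all $(U_1,\ldots,U_n)\in\mathrm{G}(m,r)^n$ outside a set of measure zero for the $n$-fold product of the uniform distribution $\mathcal{G}_I$. *)

(* Defs.v *)
From HB Require Import structures.
From mathcomp Require Import all_boot all_order all_algebra.
From mathcomp Require Import complex.
From mathcomp Require Import all_classical all_reals all_analysis.
Set Implicit Arguments.
Unset Strict Implicit.
Unset Printing Implicit Defensive.
Import Order.TTheory GRing.Theory Num.Theory.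
Local Open Scope classical_set_scope.
Local Open Scope ring_scope.

Section product_power.
Context d (T : measurableType d) (R : realType).

Definition tuple_cons n (x : T * n.-tuple T) : n.+1.-tuple T :=
  [tuple of x.1 :: x.2].

Lemma measurable_tuple_cons n : measurable_fun setT (@tuple_cons n).
Proof. exact: measurable_cons. Qed.

HB.instance Definition _ n := @isMeasurableFun.Build _ _ _ _ (@tuple_cons n)
  (@measurable_tuple_cons n).

(* The n-fold product measure of P, on the product sigma-algebra of T^n. *)
Fixpoint power_prob (P : probability T R) n : probability (n.-tuple T) R :=
  if n is n'.+1 then distribution (P \x power_prob P n')%E (@tuple_cons n')
  else \d_ [tuple].

Lemma measurable_box n (A : 'I_n -> set T) : (forall i, measurable (A i)) ->
  measurable [set x : n.-tuple T | forall i, A i (tnth x i)].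
Proof.
move=> mA; rewrite (_ : mkset _ =
    \big[setI/setT]_(i < n) ((fun x : n.-tuple T => tnth x i) @^-1` A i)).
  apply: (@bigsetI_measurable _ (n.-tuple T)) => i _.
  by rewrite -[X in measurable X]setTI; exact: (@measurable_tnth _ T n i).
rewrite -bigcap_seq; apply/seteqP; split => x /= Ax i.
  by move=> _; exact: Ax.
by apply: (Ax i); rewrite /= mem_index_enum.
Qed.

Lemma power_prob_box (P : probability T R) n (A : 'I_n -> set T) :
  (forall i, measurable (A i)) ->
  power_prob P n [set x | forall i, A i (tnth x i)] = (\prod_(i < n) P (A i))%E.
Proof.
elim: n A => [|n IH] A mA.
  rewrite big_ord0 /= diracE mem_set//= => -[] //.
rewrite big_ord_recl -IH; last by move=> i; exact: mA.
rewrite -product_measure1E//; last exact: measurable_box (fun i => mA (lift ord0 i)).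
rewrite /= /distribution /pushforward /=; congr (_ _).
apply/seteqP; split => -[x t] /=.
  move=> Ax; split; first exact: (Ax ord0).
  by move=> i; have := Ax (lift ord0 i); rewrite /tuple_cons tnthS.
move=> [Ax At] i; case: (unliftP ord0 i) => [j|] -> //.
by rewrite /tuple_cons tnthS; exact: At.
Qed.

End product_power.

Variant base_field := RealNumbers | ComplexNumbers.

Section ground_field.
Context (R : realType) (k : base_field).

Definition ground : numFieldType :=
  match k with RealNumbers => R | ComplexNumbers => R[i] end.

Definition real_dim : nat :=
  match k with RealNumbers => 1 | ComplexNumbers => 2 end.

Definition ground_conj : {rmorphism ground -> ground} :=
  match k return (let F : numFieldType :=
      match k with RealNumbers => R | ComplexNumbers => R[i] end in
    {rmorphism F -> F}) with
  | RealNumbers => idfun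
  | ComplexNumbers => Num.conj
  end.

Definition ground_re : ground -> R :=
  match k return (match k return numFieldType with
      RealNumbers => R | ComplexNumbers => R[i] end -> R) with
  | RealNumbers => idfun
  | ComplexNumbers => @complex.Re R
  end.

Definition of_coords : real_dim.-tuple R -> ground :=
  match k return
    (match k with RealNumbers => 1 | ComplexNumbers => 2 end%N.-tuple R ->
     match k return numFieldType with
      RealNumbers => R | ComplexNumbers => R[i] end) with
  | RealNumbers => fun t => t`_0
  | ComplexNumbers => fun t => (t`_0 +i* t`_1)%C
  end.

Definition adjmx m n (A : 'M[ground]_(m, n)) : 'M[ground]_(n, m) :=
  map_mx ground_conj A^T.

(* On R[i] the order of ground satisfies 0 < z iff z is real and positive. *)
Definition posdefmx m (S : 'M[ground]_m) : Prop :=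
  forall x : 'cV[ground]_m, x != 0 -> 0 < (adjmx x *m S *m x) 0 0.

Definition Pos m : set 'M[ground]_m :=
  [set S | [/\ adjmx S = S, posdefmx S & \det S = 1]].

Section grassmannian.
Context (m r : nat).
Local Notation V := 'cV[ground]_m.

(* The bound on r makes the type nonempty. *)
Definition grassmannian of (r < m)%N := {U : {vspace V} | \dim U == r}.

Context (rm : (r < m)%N).
Local Notation Gr := (grassmannian rm).

Fact grassmannian_inhabited : \dim <<take r (vbasis {:V})>>%VS == r.
Proof.
have szb : size (vbasis {:V}) = m by rewrite size_tuple dimvf /dim /= muln1.
have fb := basis_free (vbasisP {:V}).
have /eqP-> : free (take r (vbasis {:V})).
  by apply: (@catl_free _ _ (drop r (vbasis {:V}))); rewrite cat_take_drop.
by rewrite size_take szb rm.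
Qed.

HB.instance Definition _ := Choice.on Gr.
HB.instance Definition _ := isPointed.Build Gr
  (exist (fun U : {vspace V} => \dim U == r) _ grassmannian_inhabited).

(* r vectors of F^m, given by the real coordinates of their entries. *)
Definition coord_space := r.-tuple (m.-tuple (real_dim.-tuple (measurableTypeR R))).

Definition frame_of (w : coord_space) : r.-tuple V :=
  [tuple \col_i of_coords (tnth (tnth w j) i) | j < r].

(* The default value is used only when the r vectors are linearly dependent. *)
Definition span_frame (w : coord_space) : Gr :=
  insubd (point : Gr) <<frame_of w>>%VS.

(* The quotient sigma-algebra of the map sending linearly independent vectors
   to their span.  It is the Borel sigma-algebra of the Grassmannian, because
   this map is continuous and has continuous local sections. *)
Definition grassmannian_display : measure_display.
Proof. exact. Qed.

Definition grassmannian_measurable : set (set Gr) :=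
  [set A | measurable (span_frame @^-1` A)].

Let measurable0 : grassmannian_measurable set0.
Proof. by rewrite /grassmannian_measurable /= preimage_set0. Qed.

Let measurableC A :
  grassmannian_measurable A -> grassmannian_measurable (~` A).
Proof. by rewrite /grassmannian_measurable /= preimage_setC => /measurableC. Qed.

Let measurable_bigcup (A : (set Gr)^nat) :
  (forall i, grassmannian_measurable (A i)) ->
  grassmannian_measurable (\bigcup_i A i).
Proof.
move=> mA; rewrite /grassmannian_measurable /= preimage_bigcup.
exact: bigcupT_measurable.
Qed.

HB.instance Definition _ := @isMeasurable.Build grassmannian_display
  Gr grassmannian_measurable measurable0 measurableC measurable_bigcup.

Lemma measurable_span_frame : measurable_fun setT span_frame.
Proof. by move=> _ A mA; rewrite setTI. Qed.

HB.instance Definition _ := @isMeasurableFun.Build _ _ _ _ span_frame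
  measurable_span_frame.

(* The entries are standard normal variables of F: real and imaginary parts are
   independent of variance 1/2 when F is complex. *)
Definition normal_frame_prob : probability coord_space R :=
  power_prob (power_prob (power_prob
    (normal_prob 0 (Num.sqrt real_dim%:R^-1)) real_dim) m) r.

Definition grassmannian_uniform : probability Gr R :=
  distribution normal_frame_prob span_frame.

Definition basis_mx (U : Gr) : 'M[ground]_(m, \dim (val U)) :=
  \matrix_(i, j) (vbasis (val U))`_j i 0.

Definition grassmannian_density (S : 'M[ground]_m) (U : Gr) : R :=
  let X := basis_mx U in
  ground_re (\det (adjmx X *m X) / \det (adjmx X *m invmx S *m X))
    `^ ((real_dim * m)%:R / 2).

Lemma basis_mxE (U : Gr) (X : 'M[ground]_(m, r)) :
  limg (linfun (mulmx X : 'cV_r -> V)) = val U ->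
  exists (P : 'M[ground]_(r, \dim (val U))) (Q : 'M[ground]_(\dim (val U), r)),
    basis_mx U = X *m P /\ Q *m P = 1%:M.
Proof.
set f := linfun _; set W := val U => fW.
pose P : 'M[ground]_(r, \dim W) := \matrix_(i, j) (f^-1)%VF (vbasis W)`_j i 0.
pose Q : 'M[ground]_(\dim W, r) := \matrix_(i, j) coord (vbasis W) i (col j X).
have BP : basis_mx U = X *m P.
  apply/matrixP => i j; rewrite !mxE.
  have bW : (vbasis W)`_j \in limg f.
    by rewrite fW vbasis_mem// mem_nth// size_tuple.
  rewrite -[in LHS](limg_lfunVK bW) lfunE /= mxE.
  by apply: eq_bigr => l _; rewrite !mxE.
have XQ : X = basis_mx U *m Q.
  apply/matrixP => i j; rewrite mxE.
  have XW : col j X \in W.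
    rewrite -fW; apply/memv_imgP; exists (delta_mx j 0); first exact: memvf.
    by rewrite lfunE /= colE.
  have -> : X i j = col j X i 0 by rewrite mxE.
  rewrite {1}(coord_vbasis XW) summxE; apply: eq_bigr => l _.
  by rewrite !mxE mulrC.
exists P, Q; split=> //.
have BD : basis_mx U *m (Q *m P - 1%:M) = 0.
  by rewrite mulmxBr mulmxA -XQ -BP mulmx1 subrr.
apply/eqP; rewrite -subr_eq0; apply/eqP; move: BD.
set D := Q *m P - 1%:M => BD; apply/matrixP => i j; rewrite [RHS]mxE.
have /freeP/(_ (fun l => D l j)) := basis_free (vbasisP W); apply.
apply/colP => l; have /matrixP/(_ l j) := BD.
rewrite !mxE => BDlj; rewrite summxE -[RHS]BDlj; apply: eq_bigr => l' _.
by rewrite !mxE mulrC.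
Qed.

Lemma adjmxM p q s (A : 'M[ground]_(p, q)) (B : 'M[ground]_(q, s)) :
  adjmx (A *m B) = adjmx B *m adjmx A.
Proof. by rewrite /adjmx trmx_mul map_mxM. Qed.

(* The density does not depend on the basis: U can be given as the range of any
   m x r matrix X. *)
Lemma grassmannian_densityE (S : 'M[ground]_m) (U : Gr) (X : 'M[ground]_(m, r)) :
  limg (linfun (mulmx X : 'cV_r -> V)) = val U ->
  grassmannian_density S U =
  ground_re (\det (adjmx X *m X) / \det (adjmx X *m invmx S *m X))
    `^ ((real_dim * m)%:R / 2).
Proof.
move=> /basis_mxE[]; rewrite /grassmannian_density.
move: (basis_mx U); rewrite (eqP (valP U)) => B P [Q [-> QP]].
congr (ground_re _ `^ _).
have dP : \det P != 0.
  apply/eqP => P0; have := congr1 determinant QP.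
  by rewrite det_mulmx P0 mulr0 det1 => /eqP; rewrite eq_sym oner_eq0.
have E (M : 'M[ground]_m) : \det (adjmx (X *m P) *m M *m (X *m P)) =
    \det (adjmx X *m M *m X) * (ground_conj (\det P) * \det P).
  have -> : adjmx (X *m P) *m M *m (X *m P) =
      adjmx P *m (adjmx X *m M *m X) *m P by rewrite adjmxM !mulmxA.
  have dPa : \det (adjmx P) = ground_conj (\det P).
    by rewrite /adjmx det_map_mx det_tr.
  by rewrite !det_mulmx -dPa -mulrA mulrCA mulrA.
have E1 := E 1%:M; rewrite !mulmx1 in E1.
rewrite E1 E -mulf_div divff ?mulr1// mulf_neq0//.
by rewrite fmorph_eq0.
Qed.

Definition log_likelihood n (u : n.-tuple Gr) (S : 'M[ground]_m) : R :=
  n%:R^-1 * \sum_(k < n) ln (grassmannian_density S (tnth u k)).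

Definition is_GE n (u : n.-tuple Gr) (S : 'M[ground]_m) : Prop :=
  Pos S /\ forall S', Pos S' -> log_likelihood u S' <= log_likelihood u S.

End grassmannian.
End ground_field.

(* Main.v *)
(* The likelihood of Sigma depends, with S = Sigma^-1 and frames X_k of the
   U_k, only on the product of the determinants of X_k^* S X_k, which has to be
   minimized over Pos.

   Call the sample stable if nr dim V > m sum_k dim(U_k /\ V) for all proper
   nonzero subspaces V. Taking V = ker A this reads
   nr rank(A) < m sum_k rank(A X_k).

   Stable samples have exactly one minimizer: writing S = g^* diag(d) g, the
   Cauchy-Binet formula turns det(X_k^* S X_k) into a sum over r-sets J of
   prod_(i in J) d_i times the squared modulus of the J-th minor of g X_k. For
   every weight vector a = log d with sum 0, stability provides nonzero minors
   J_k with m sum_k sum_(i in J_k) a_i >= max a - min a. Over the compact set of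
   unitary matrices g this gives coercivity, hence existence. If S and S' are
   two minimizers, diagonalize both by the same h; at h^* diag(sqrt(d d')) h the
   Cauchy-Schwarz inequality for the Cauchy-Binet sums must be an equality, and
   the weight inequality applied to a = log(d'/d) and to -a forces a = 0.

   Almost all samples are stable: the frames of unstable samples lie in finitely
   many images of quadratic maps, by Schubert cells, and when
   n r (m - r) > m ^ 2 each map has fewer than n m r variables. Hence the entries
   of the frames satisfy a nontrivial polynomial equation, and zero sets of
   polynomials are null by Fubini. To get an exceptional set that is measurable
   for the product of the quotient sigma-algebras, the polynomial is evaluated at
   the frames P_k G, with P_k the orthogonal projection onto U_k, for all
   matrices G of natural numbers. *)
From HB Require Import structures.
Require Import Defs.
From mathcomp Require Import all_boot all_order all_fingroup all_algebra.
From mathcomp Require Import boolp.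
From mathcomp Require Import ring lra zify.
Set Implicit Arguments.
Unset Strict Implicit.
Unset Printing Implicit Defensive.
Import Order.TTheory GRing.Theory Num.Theory.
Local Open Scope ring_scope.

(** * Polynomial functions *)

Section polyfun.
Context (F : comNzRingType).

(* The index bounds the total degree. *)
Inductive polyfun (I : Type) : nat -> ((I -> F) -> F) -> Prop :=
| polyfun_cst d c : polyfun d (fun=> c)
| polyfun_var d i : polyfun d.+1 (fun x => x i)
| polyfun_add d f g : polyfun d f -> polyfun d g -> polyfun d (fun x => f x + g x)
| polyfun_mul d e f g :
    polyfun d f -> polyfun e g -> polyfun (d + e) (fun x => f x * g x).

Lemma polyfun_leq (I : Type) d e (f : (I -> F) -> F) :
  (d <= e)%N -> polyfun d f -> polyfun e f.
Proof.
move=> + pf; elim: pf e => {d f}.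
- by move=> d c e _; exact: polyfun_cst.
- by move=> d i [//|e] _; exact: polyfun_var.
- by move=> d f g _ IHf _ IHg e de; apply: polyfun_add; [exact: IHf|exact: IHg].
move=> d d' f g _ IHf _ IHg e de.
rewrite -(@subnK d' e); last exact: leq_trans (leq_addl _ _) de.
by apply: polyfun_mul; [apply: IHf; lia | apply: IHg].
Qed.

Lemma polyfun_sum (I : Type) (J : Type) (s : seq J) (P : pred J) d
    (f : J -> (I -> F) -> F) :
  (forall j, P j -> polyfun d (f j)) ->
  polyfun d (fun x => \sum_(j <- s | P j) f j x).
Proof.
move=> pf; elim: s => [|j s IH].
  rewrite (_ : (fun x => _) = (fun=> 0)); first exact: polyfun_cst.
  by apply/funext => x; rewrite big_nil.
have [Pj|Pj] := boolP (P j); last first.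
  by move: IH; congr polyfun; apply/funext => x; rewrite big_cons (negPf Pj).
rewrite (_ : (fun x => _) = fun x => f j x + \sum_(i <- s | P i) f i x).
  by apply: polyfun_add; first exact: pf.
by apply/funext => x; rewrite big_cons Pj.
Qed.

Lemma polyfun_prod (I : Type) (J : Type) (s : seq J) d (f : J -> (I -> F) -> F) :
  (forall j, polyfun d (f j)) ->
  polyfun (size s * d) (fun x => \prod_(j <- s) f j x).
Proof.
move=> pf; elim: s => [|j s IH].
  rewrite (_ : (fun x => _) = (fun=> 1)); first exact: polyfun_cst.
  by apply/funext => x; rewrite big_nil.
rewrite (_ : (fun x => _) = fun x => f j x * \prod_(i <- s) f i x).
  by rewrite /= mulSn; apply: polyfun_mul.
by apply/funext => x; rewrite big_cons.
Qed.

Lemma polyfun_comp (I J : Type) d e (f : (I -> F) -> F) (phi : (J -> F) -> I -> F) :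
  polyfun d f -> (forall i, polyfun e (fun x => phi x i)) ->
  polyfun (d * e) (fun x => f (phi x)).
Proof.
move=> pf pphi; elim: pf => {d f}.
- by move=> d c; exact: polyfun_cst.
- move=> d i; apply: (@polyfun_leq _ e); first exact: leq_pmull.
  exact: pphi.
- by move=> d f g _ IHf _ IHg; exact: polyfun_add.
by move=> d d' f g _ IHf _ IHg; rewrite mulnDl; exact: polyfun_mul.
Qed.

(** On a line a polynomial function is a univariate polynomial, so the vanishing arguments below
    reduce to counting roots. *)
Lemma polyfun_line (I : Type) d (f : (I -> F) -> F) (a b : I -> F) :
  polyfun d f -> exists2 p : {poly F}, (size p <= d.+1)%N &
    forall t, f (fun i => a i + t * b i) = p.[t].
Proof.
elim=> {d f}.
- move=> d c; exists c%:P => [|t]; last by rewrite hornerC.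
  by rewrite (leq_trans (size_polyC_leq1 _)).
- move=> d i; exists ((a i)%:P + (b i)%:P * 'X) => [|t].
    rewrite (leq_trans (size_polyD _ _))// geq_max.
    rewrite (leq_trans (size_polyC_leq1 _))//=.
    rewrite (leq_trans (size_polyMleq _ _))// size_polyX.
    by have := size_polyC_leq1 (b i); lia.
  by rewrite !hornerE mulrC.
- move=> d f g _ [p sp pf] _ [q sq qg]; exists (p + q) => [|t].
    by rewrite (leq_trans (size_polyD _ _))// geq_max sp.
  by rewrite hornerD pf qg.
move=> d e f g _ [p sp pf] _ [q sq qg]; exists (p * q) => [|t].
  by rewrite (leq_trans (size_polyMleq _ _))//; lia.
by rewrite hornerM pf qg.
Qed.

End polyfun.

Section polyfun_field.
Context (F : numFieldType).

(* Coordinates are freed one at a time: along each of them the function is a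
   univariate polynomial of degree at most d with d + 1 roots. *)
Lemma polyfun_grid_eq0 (I : finType) d (f : (I -> F) -> F) : polyfun d f ->
  (forall e : {ffun I -> 'I_d.+1}, f (fun i => (e i)%:R) = 0) -> forall x, f x = 0.
Proof.
move=> pf f0 x.
(* [s] lists the coordinates already freed; the others keep their grid values from [e]. *)
suff H (s : seq I) (e : {ffun I -> 'I_d.+1}) :
    f (fun i => if i \in s then x i else (e i)%:R) = 0.
  have := H (enum I) [ffun=> ord0]; congr (f _ = 0).
  by apply/funext => i; rewrite mem_enum.
elim: s e => [|j s IH] e; first exact: f0.
have [js|js] := boolP (j \in s).
  rewrite -(IH e); congr f; apply/funext => i.
  by rewrite inE; case: eqP => //= ->; rewrite js.
(* This line moves coordinate [j] alone, and its parameter is the value taken there. The induction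
   hypothesis supplies the roots 0, ..., d. *)
have [p sp fp] := polyfun_line
  (fun i => if i == j then 0 else if i \in s then x i else (e i)%:R)
  (fun i => (i == j)%:R) pf.
have p0 : p = 0.
  apply/eqP; apply/negPn/negP => p0.
  have /(max_poly_roots p0) : all (root p) [seq i%:R | i <- iota 0 d.+1].
    apply/allP => y /mapP[i]; rewrite mem_iota add0n => id ->{y}.
    rewrite rootE -fp -[X in _ == X](IH [ffun l => if l == j then inord i else e l]).
    apply/eqP; congr f; apply/funext => l; rewrite !ffunE.
    case: eqP => [->|_]; last by rewrite mulr0 addr0.
    by rewrite (negPf js) mulr1 add0r inordK.
  rewrite map_inj_in_uniq ?iota_uniq; last first.
    by move=> a b _ _ /eqP; rewrite eqr_nat => /eqP.
  by rewrite size_map size_iota ltnNge sp => /(_ isT).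
have := fp (x j); rewrite p0 horner0 => <-; congr f; apply/funext => i.
rewrite inE; case: eqP => [->|_]; last by rewrite mulr0 addr0.
by rewrite mulr1 add0r.
Qed.

(** On the line through [x] and [y], [f] is nonzero at parameter 0 and [g] at parameter 1. The
    product of the two univariate polynomials is then nonzero and has only finitely many roots. *)
Lemma polyfun_mul_neq0 (I : Type) d e (f g : (I -> F) -> F) x y :
  polyfun d f -> polyfun e g -> f x != 0 -> g y != 0 -> exists z, f z * g z != 0.
Proof.
move=> pf pg fx gy; apply: contrapT => nz.
have z0 z : f z * g z = 0 by apply: contrapT => /eqP fgz; apply: nz; exists z.
have [p _ pE] := polyfun_line x (fun i => y i - x i) pf.
have [q _ qE] := polyfun_line x (fun i => y i - x i) pg.
have p0 : p != 0.
  apply: contraNneq fx => p0; rewrite -(horner0 0) -p0 -pE; apply/eqP; congr f.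
  by apply/funext => i; rewrite mul0r addr0.
have q0 : q != 0.
  apply: contraNneq gy => q0; rewrite -(horner0 1) -q0 -qE; apply/eqP; congr g.
  by apply/funext => i; rewrite mul1r addrC subrK.
have /(max_poly_roots (mulf_neq0 p0 q0)) : all (root (p * q))
    [seq i%:R | i <- iota 0 (size (p * q))].
  by apply/allP => _ /mapP[i _ ->]; rewrite rootE hornerM -pE -qE z0.
rewrite map_inj_in_uniq ?iota_uniq => [|a b _ _ /eqP]; last first.
  by rewrite eqr_nat => /eqP.
by rewrite size_map size_iota ltnn => /(_ isT).
Qed.

(** Merges finitely many nontrivial polynomial equations into a single nontrivial one that holds
    wherever one of them does. *)
Lemma polyfun_prod_neq0 (I J : Type) (s : seq J) (P : J -> (I -> F) -> F) :
  (forall j, (exists e, polyfun e (P j)) /\ exists x, P j x != 0) ->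
  (exists e, polyfun e (fun x => \prod_(j <- s) P j x)) /\
  exists x, \prod_(j <- s) P j x != 0.
Proof.
move=> PP; elim: s => [|j s [[e pe] [x xs]]].
  split; [exists 0%N|exists (fun=> 0)]; last by rewrite big_nil oner_neq0.
  rewrite (_ : (fun x => _) = fun=> 1); first exact: polyfun_cst.
  by apply/funext => x; rewrite big_nil.
have [[d pd] [y yj]] := PP j; split; last first.
  by have [z zP] := polyfun_mul_neq0 pd pe yj xs; exists z; rewrite big_cons.
exists (d + e)%N; rewrite (_ : (fun x => _) = fun x => P j x * \prod_(i <- s) P i x).
  exact: polyfun_mul.
by apply/funext => z; rewrite big_cons.
Qed.

(** The Lagrange interpolation function, not normalized, of the node [e] in the grid of points with
    coordinates 0, ..., D - 1. *)
Definition grid_lagrange (I : finType) D (e : {ffun I -> 'I_D}) (x : I -> F) : F :=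
  \prod_i \prod_(j : 'I_D) (if j == e i then 1 else x i - j%:R).

Lemma polyfun_grid_lagrange (I : finType) D (e : {ffun I -> 'I_D}) :
  polyfun (#|I| * D) (grid_lagrange e).
Proof.
have -> : #|I| = size (index_enum I) by rewrite [index_enum _]unlock cardT enumT.
rewrite /grid_lagrange; apply: polyfun_prod => i.
apply: (@polyfun_leq _ _ (size (index_enum 'I_D) * 1)).
  by rewrite muln1 [index_enum _]unlock -enumT size_enum_ord.
apply: polyfun_prod => j; case: (j == e i); first exact: polyfun_cst.
exact: (@polyfun_add F I 1 (fun x => x i) (fun=> - j%:R)
  (@polyfun_var F I 0 i) (@polyfun_cst F I 1 (- j%:R))).
Qed.

Lemma grid_lagrange_neq0 (I : finType) D (e e' : {ffun I -> 'I_D}) :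
  (grid_lagrange e (fun i => (e' i)%:R) != 0) = (e == e').
Proof.
apply/idP/eqP => [|<-].
  move=> /prodf_neq0 L; apply/ffunP => i; apply/eqP.
  have /prodf_neq0/(_ (e' i) isT) := L i isT.
  by case: (eqVneq (e' i) (e i)) => // _; rewrite subrr eqxx.
apply/prodf_neq0 => i _; apply/prodf_neq0 => j _.
case: ifP => [_|/negbT ij]; first exact: oner_neq0.
by rewrite subr_eq0 eqr_nat eq_sym.
Qed.

Lemma left_kernel_ltn (m n : nat) (A : 'M[F]_(m, n)) : (n < m)%N ->
  exists2 v : 'rV_m, v != 0 & v *m A = 0.
Proof.
move=> nm; have : kermx A != 0.
  by rewrite -mxrank_eq0 mxrank_ker -lt0n subn_gt0 (leq_ltn_trans (rank_leq_col _)).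
move=> /rowV0Pn[v /sub_kermxP vA v0]; by exists v.
Qed.

(** Take D above (C + 1)^M: then (C D + 1)^M <= ((C + 1) D)^M < D^(M + 1) <= D^N. *)
Lemma expn_growth (M N C : nat) : (M < N)%N ->
  exists2 D, (0 < D)%N & ((C * D).+1 ^ M < D ^ N)%N.
Proof.
move=> MN; have [D D0 CD] : exists2 D, (0 < D)%N & (C.+1 ^ M < D)%N.
  by exists (C.+1 ^ M).+1.
exists D => //.
apply: (@leq_ltn_trans ((C.+1 * D) ^ M)).
  case: (posnP M) => [->//|M0]; rewrite leq_exp2r// mulSn.
  by move: (C * D)%N => n; lia.
rewrite expnMn; apply: (@leq_trans (D ^ M.+1)); last by rewrite leq_pexp2l.
by rewrite expnS ltn_pmul2r// expn_gt0 D0.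
Qed.

(* Dimension count: the combinations of the D ^ #|I| functions
   [grid_lagrange e \o phi] are determined by their values on a grid with
   (C D + 1) ^ M points. *)
Lemma polyfun_dependence (I : finType) (M d : nat) (phi : ('I_M -> F) -> I -> F) :
  (M < #|I|)%N -> (forall i, polyfun d (fun x => phi x i)) ->
  exists (e : nat) (P : (I -> F) -> F), [/\ polyfun e P,
    exists x, P x != 0 & forall x, P (phi x) = 0].
Proof.
move=> MI pphi; have [D D0 HD] := expn_growth (#|I| * d) MI.
(* [C * D] bounds the degree of [grid_lagrange e \o phi]: a function of degree [#|I| * D] is
   composed with functions of degree [d]. *)
pose E := {ffun I -> 'I_D}; set C := (#|I| * d)%N in HD.
pose G := {ffun 'I_M -> 'I_(C * D).+1}.
pose A : 'M[F]_(#|E|, #|G|) := \matrix_(i, j)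
  grid_lagrange (enum_val i) (phi (fun l => ((enum_val j : G) l)%:R)).
have [v v0 vA] : exists2 v : 'rV_#|E|, v != 0 & v *m A = 0.
  by apply: left_kernel_ltn; rewrite !card_ffun !card_ord.
pose P x := \sum_(i < #|E|) v 0 i * grid_lagrange (enum_val i) x.
have pP : polyfun (#|I| * D) P.
  apply: polyfun_sum => i _; rewrite -[(_ * D)%N]add0n.
  by apply: polyfun_mul; [exact: polyfun_cst|exact: polyfun_grid_lagrange].
exists (#|I| * D)%N, P; split=> //.
  have [i vi] : exists i, v 0 i != 0.
    apply/existsP; apply: contraNT v0; rewrite negb_exists => /forallP v0.
    by apply/eqP/rowP => i; rewrite mxE; apply/eqP; have := v0 i; rewrite negbK.
  (* At the node of index [i] every Lagrange function except the [i]-th vanishes, so [P] takes a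
     nonzero multiple of [v 0 i] as its value. *)
  exists (fun l => ((enum_val i : E) l)%:R); rewrite /P (bigD1 i)//= big1 => [|j ji].
    by rewrite addr0 mulf_neq0// grid_lagrange_neq0.
  apply/eqP; rewrite mulf_eq0; apply/orP; right; rewrite -[_ == _]negbK.
  by rewrite grid_lagrange_neq0 (inj_eq enum_val_inj).
apply: (@polyfun_grid_eq0 _ (C * D)).
  by rewrite /C mulnAC; exact: polyfun_comp.
move=> g; have /rowP/(_ (enum_rank g)) := vA; rewrite !mxE => <-.
by apply: eq_bigr => i _; rewrite mxE enum_rankK.
Qed.

(** Setting the variables outside [S] to 0, as [ext] does, leaves a map in [#|S|] variables with the
    same image. This permits one type of variables for all pivot patterns. *)
Lemma polyfun_dependence_in (I J : finType) (S : {set J}) (d : nat)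
    (phi : (J -> F) -> I -> F) :
  (#|S| < #|I|)%N -> (forall i, polyfun d (fun x => phi x i)) ->
  (forall x y, {in S, x =1 y} -> phi x = phi y) ->
  exists (e : nat) (P : (I -> F) -> F), [/\ polyfun e P,
    exists x, P x != 0 & forall x, P (phi x) = 0].
Proof.
move=> SI pphi phiS.
pose ext (y : 'I_#|S| -> F) j := \sum_(i < #|S|) (enum_val i == j)%:R * y i.
have [|e [P [pP P0 Pphi]]] :=
    @polyfun_dependence I #|S| (d * 1) (fun y => phi (ext y)) SI _.
  move=> i; apply: (@polyfun_comp _ _ _ _ _ (fun x => phi x i) ext) => // j.
  apply: polyfun_sum => l _; rewrite -[1%N]add0n.
  by apply: polyfun_mul; [exact: polyfun_cst|exact: polyfun_var].
exists e, P; split=> // x; rewrite -[RHS](Pphi (fun i => x (enum_val i))).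
congr P; apply: phiS => j jS; rewrite /ext (bigD1 (enum_rank_in jS j))//=.
rewrite enum_rankK_in// eqxx mul1r big1 ?addr0// => i ij.
case: eqP => [ij'|_]; last by rewrite mul0r.
by case/eqP: ij; apply: enum_val_inj; rewrite ij' enum_rankK_in.
Qed.

End polyfun_field.

(** * Unstable tuples of subspaces *)

(* Convexity: compare each s k with the mean value r d / m. *)
Lemma schubert_codim_gt (R : realDomainType) (n : nat) (s : 'I_n -> R) (m r d : R) :
  0 < d -> d < m -> 0 < r -> r < m -> m ^+ 2 < n%:R * (r * (m - r)) ->
  n%:R * r * d <= m * \sum_k s k ->
  d * (m - d) < \sum_k s k * (s k + m - r - d).
Proof.
move=> d0 dm r0 rm mn sum_s; set T := \sum_k s k in sum_s.
pose Q := \sum_k s k ^+ 2.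
have -> : \sum_k s k * (s k + m - r - d) = Q + (m - r - d) * T.
  by rewrite /Q /T mulr_sumr -big_split /=; apply: eq_bigr => k _; ring.
have sq : 0 <= m ^+ 2 * Q - 2 * m * r * d * T + n%:R * (r * d) ^+ 2.
  have -> : m ^+ 2 * Q - 2 * m * r * d * T + n%:R * (r * d) ^+ 2 =
      \sum_k (m * s k - r * d) ^+ 2.
    rewrite (_ : n%:R * (r * d) ^+ 2 = \sum_(k < n) (r * d) ^+ 2); last first.
      by rewrite sumr_const card_ord mulr_natl.
    rewrite /Q /T !mulr_sumr -sumrB -big_split /=; apply: eq_bigr => k _; ring.
  by apply: sumr_ge0 => k _; exact: sqr_ge0.
(* By [sq], m^2 times the right-hand side is at least (2 r d + m (m - r - d)) m T - n (r d)^2, and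
   the coefficient of m T is r d + (m - r) (m - d). With [sum_s] the bound becomes n r d (m - r) (m
   - d). *)
have c0 : 0 <= r * d + (m - r) * (m - d).
  by apply: addr_ge0; apply: mulr_ge0; lra.
have h1 := ler_wpM2l c0 sum_s.
have h2 : m ^+ 2 * (d * (m - d)) < n%:R * (r * (m - r)) * (d * (m - d)).
  by rewrite ltr_pM2r// mulr_gt0// subr_gt0.
have m2 : 0 < m ^+ 2 by rewrite exprn_gt0// (lt_trans d0).
rewrite -(ltr_pM2l m2); lra.
Qed.

Section pivots.
Context (F : fieldType).

(** A maximal independent set of columns, found as rows of the transpose. [B] holds the coefficients
    of all columns in this basis. *)
Lemma column_pivots p q (A : 'M[F]_(p, q)) : exists (I : {set 'I_q}) (B : 'M[F]_q),
  [/\ #|I| = \rank A,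
      forall i j, A i j = \sum_(l in I) A i l * B l j &
      forall c : 'cV_q, (forall l, l \notin I -> c l 0 = 0) -> A *m c = 0 -> c = 0].
Proof.
pose f := maxrankfun A^T; pose M := rowsub f A^T.
have finj : injective f := @maxrankfun_inj _ _ _ A^T.
have [D AD] : exists D, A^T = D *m M.
  by apply/submxP; rewrite (eq_maxrowsub A^T).
exists [set f l | l : 'I_(\rank A^T)].
exists (\matrix_(i, j) \sum_l (f l == i)%:R * D j l); split.
- by rewrite card_imset// card_ord mxrank_tr.
- move=> i j; rewrite big_imset/=; last by move=> x y _ _; exact: finj.
  transitivity (A^T j i); first by rewrite mxE.
  have /matrixP/(_ j i) -> := AD; rewrite mxE; apply: eq_bigr => l _.
  rewrite !mxE mulrC; congr (_ * _).
  rewrite (bigD1 l)//= eqxx mul1r big1 ?addr0// => l' l'l.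
  by rewrite (inj_eq finj) (negPf l'l) mul0r.
move=> c cI Ac.
have : (\row_l c (f l) 0) *m M = 0.
  apply/rowP => i; rewrite mxE [RHS]mxE.
  transitivity ((A *m c) i 0); last by rewrite Ac mxE.
  rewrite mxE (bigID (mem [set f l | l : 'I_(\rank A^T)]))/= [X in _ + X]big1.
    rewrite addr0 big_imset/=; last by move=> x y _ _; exact: finj.
    by apply: eq_bigr => l _; rewrite !mxE mulrC.
  by move=> l /cI ->; rewrite mulr0.
move=> /eqP; rewrite mulmx_free_eq0 ?maxrowsub_free// => /eqP/rowP c0.
apply/colP => i; rewrite [RHS]mxE.
have [/imsetP[l _ ->]|/cI//] := boolP (i \in [set f l | l : 'I_(\rank A^T)]).
by have := c0 l; rewrite !mxE.
Qed.

End pivots.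

Section unstable.
Context (F : numFieldType) (n m r : nat).

(* With V = ker A and U k the range of X k, dim V = m - rank A and
   dim (U k :&: V) = r - rank (A X k). *)
Definition stable (X : 'I_n -> 'M[F]_(m, r)) :=
  forall A : 'M[F]_m, (0 < \rank A < m)%N ->
    (n * r * \rank A < m * \sum_k \rank (A *m X k))%N.

Let param : Type := (('I_m * 'I_m) + 'I_n * ('I_m * 'I_r + ('I_r * 'I_r + 'I_m * 'I_r)))%type.

Section parametrization.
Context (I : {set 'I_m}) (N : 'I_n -> {set 'I_r}).

(* Let I index the pivot columns of A and N k those of A Y_k. The columns of Y_k
   outside N k are combinations of the others up to vectors v of ker A, and such
   a v is determined by its entries outside I: v_i = sum_l b_(i,l) v_l. The
   variables are b, the entries y of the columns in N k, the coefficients q of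
   the combinations and the free entries c of the vectors v. *)
Definition pb i l : param := inl (i, l).
Definition py k i j : param := inr (k, inl (i, j)).
Definition pq k j' j : param := inr (k, inr (inl (j', j))).
Definition pc k l j : param := inr (k, inr (inr (l, j))).

Definition param_set : {set param} := [set x : param |
  match x with
  | inl (i, l) => (i \in I) && (l \notin I)
  | inr (k, inl (_, j)) => j \in N k
  | inr (k, inr (inl (j', j))) => (j' \in N k) && (j \notin N k)
  | inr (k, inr (inr (l, j))) => (l \notin I) && (j \notin N k)
  end].

Definition param_map (p : param -> F) (x : 'I_n * ('I_m * 'I_r)) : F :=
  let: (k, (i, j)) := x in
  if j \in N k then p (py k i j) else
  \sum_(j' in N k) p (py k i j') * p (pq k j' j) +
  (if i \in I then \sum_(l in ~: I) p (pb i l) * p (pc k l j) else p (pc k i j)).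

Lemma card_param_set : #|param_set| =
  (#|I| * #|~: I| + \sum_k (m * #|N k| + (#|N k| * #|~: N k| + #|~: I| * #|~: N k|)))%N.
Proof.
rewrite -sum1_card big_sumType /=; congr (_ + _)%N.
  by rewrite -cardsX -sum1_card; apply: eq_bigl => -[i l]; rewrite !inE.
rewrite (eq_bigl (fun x => true && (inr (x.1, x.2) \in param_set))); last by case.
rewrite -(pair_big_dep xpredT (fun k y => inr (k, y) \in param_set) (fun _ _ => 1%N)) /=.
apply: eq_bigr => k _; rewrite !big_sumType /=; congr (_ + (_ + _))%N.
- rewrite -[X in (X * _)%N]card_ord -cardsT -cardsX -sum1_card.
  by apply: eq_bigl => -[i j]; rewrite !inE.
- by rewrite -cardsX -sum1_card; apply: eq_bigl => -[i j]; rewrite !inE.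
by rewrite -cardsX -sum1_card; apply: eq_bigl => -[i j]; rewrite !inE.
Qed.

Lemma polyfun_param_map x : polyfun 2 (fun p => param_map p x).
Proof.
have pv y : polyfun 1 (fun p : param -> F => p y) := @polyfun_var _ _ 0 y.
case: x => k [i j]; rewrite /param_map; case: (j \in N k).
  exact: polyfun_leq (pv _).
apply: polyfun_add.
  by apply: polyfun_sum => j' _; exact: (polyfun_mul (pv _) (pv _)).
case: (i \in I); last exact: polyfun_leq (pv _).
by apply: polyfun_sum => l _; exact: (polyfun_mul (pv _) (pv _)).
Qed.

Lemma param_map_eq_in p q : {in param_set, p =1 q} -> param_map p = param_map q.
Proof.
move=> epq; apply/funext => -[k [i j]]; rewrite /param_map.
have [jN|jN] := boolP (j \in N k); first by apply: epq; rewrite inE.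
congr (_ + _).
  by apply: eq_bigr => j' j'N; congr (_ * _); apply: epq; rewrite inE /= j'N.
have [iI|iI] := boolP (i \in I); last by apply: epq; rewrite inE /= iI.
apply: eq_bigr => l; rewrite inE => lI.
by congr (_ * _); apply: epq; rewrite inE /= lI ?iI.
Qed.

End parametrization.

(** The variables are read off from [Y] once pivot columns of [A] and of each A Y_k are chosen. The
    ranks are recorded by the cardinals of [I] and [N]. *)
Lemma unstable_param_map (Y : 'I_n -> 'M[F]_(m, r)) (A : 'M[F]_m) :
  exists (I : {set 'I_m}) (N : {ffun 'I_n -> {set 'I_r}}) p,
    [/\ #|I| = \rank A, forall k, #|N k| = \rank (A *m Y k) &
        param_map I N p = fun x => Y x.1 x.2.1 x.2.2].
Proof.
have [I [B [cI AB Aind]]] := column_pivots A.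
have /choice[NQ NQP] : forall k, exists NQ : {set 'I_r} * 'M[F]_r,
    #|NQ.1| = \rank (A *m Y k) /\
    forall i j, (A *m Y k) i j = \sum_(l in NQ.1) (A *m Y k) i l * NQ.2 l j.
  by move=> k; have [N [Q [? ? _]]] := column_pivots (A *m Y k); exists (N, Q).
pose N := [ffun k => (NQ k).1]; pose Q k := (NQ k).2.
(* What remains of column j of Y_k after subtracting the combination of pivot columns that agrees
   with it modulo ker A. *)
pose v k j := \col_i (Y k i j - \sum_(j' in N k) Y k i j' * Q k j' j).
have Av k j : A *m v k j = 0.
  apply/colP => i; rewrite [RHS]mxE mxE.
  under eq_bigr => l _ do rewrite mxE mulrBr mulr_sumr.
  rewrite sumrB exchange_big /= (_ : \sum_l _ = (A *m Y k) i j); last by rewrite mxE.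
  rewrite (NQP k).2 /N ffunE; apply/eqP; rewrite subr_eq0; apply/eqP.
  apply: eq_bigr => l _; rewrite mxE mulr_suml; apply: eq_bigr => l' _.
  by rewrite mulrA.
have vI k j i : i \in I -> v k j i 0 = \sum_(l in ~: I) - B i l * v k j l 0.
  (* [c] is supported on the pivot set [I] and A c = A v = 0, so the independence of the pivot
     columns forces c = 0. *)
  move=> iI; pose c := \col_i
    (if i \in I then v k j i 0 + \sum_(l in ~: I) B i l * v k j l 0 else 0).
  have c0 : c = 0.
    apply: Aind => [l lI|]; first by rewrite mxE (negPf lI).
    apply/colP => a; rewrite [RHS]mxE.
    transitivity ((A *m v k j) a 0); last by rewrite Av mxE.
    rewrite [LHS]mxE [RHS]mxE (bigID (mem I))/= [X in _ + X]big1 => [|l /negPf lI]; last first.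
      by rewrite mxE lI mulr0.
    rewrite addr0 [RHS](bigID (mem I))/=.
    rewrite (eq_bigr (fun l => A a l * v k j l 0 +
        \sum_(l' in ~: I) A a l * B l l' * v k j l' 0)); last first.
      move=> l lI; rewrite [c l 0]mxE lI mulrDr mulr_sumr; congr (_ + _).
      by apply: eq_bigr => l' _; rewrite mulrA.
    rewrite big_split /= exchange_big /=; congr (_ + _).
    under [RHS]eq_bigl do rewrite -in_setC.
    by apply: eq_bigr => l _; rewrite (AB a l) mulr_suml.
  have /colP/(_ i) := c0; rewrite [LHS]mxE [RHS]mxE iI => /eqP.
  rewrite addr_eq0 => /eqP ->; rewrite -sumrN.
  by apply: eq_bigr => l _; rewrite mulNr.
exists I, N, (fun x : param => match x with
  | inl (i, l) => - B i l
  | inr (k, inl (i, j)) => Y k i j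
  | inr (k, inr (inl (j', j))) => Q k j' j
  | inr (k, inr (inr (l, j))) => v k j l 0
  end); split=> //.
  by move=> k; rewrite /N ffunE (NQP k).1.
apply/funext => -[k [i j]]; rewrite /param_map /=.
case: ifP => // jN.
have -> : Y k i j = \sum_(j' in N k) Y k i j' * Q k j' j + v k j i 0.
  by rewrite mxE addrC subrK.
by congr (_ + _); case: ifP => // iI; rewrite vI.
Qed.

(** With d = m - |I| and s_k = r - |N k|, standing for dim V and dim(U_k /\ V), the number of
    variables is n m r + d (m - d) - sum_k s_k (s_k + m - r - d). Here d (m - d) is the dimension of
    the Grassmannian containing V, and each term of the sum is the codimension of a Schubert
    condition. *)
Lemma card_param_set_lt (I : {set 'I_m}) (N : 'I_n -> {set 'I_r}) :
  (r < m)%N -> (0 < r)%N -> (m ^ 2 < n * (r * (m - r)))%N ->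
  (0 < #|I| < m)%N -> (m * \sum_k #|N k| <= n * r * #|I|)%N ->
  (#|param_set I N| < #|{: 'I_n * ('I_m * 'I_r)}|)%N.
Proof.
move=> rm r0 mn /andP[I0 Im] NI.
rewrite card_param_set !card_prod !card_ord.
have cI := cardsC I; rewrite card_ord in cI.
have cN k := cardsC (N k).
pose d : int := #|~: I|%:R; pose s k : int := #|~: N k|%:R.
have Id : #|I|%:R = m%:R - d by apply/eqP; rewrite eq_sym subr_eq -natrD cI.
have Ns k : #|N k|%:R = r%:R - s k.
  by apply/eqP; rewrite eq_sym subr_eq -natrD cN card_ord.
have sumN : (\sum_k #|N k|)%:R = n%:R * r%:R - \sum_k s k.
  rewrite natr_sum (eq_bigr (fun k => r%:R - s k)) => [|k _]; last exact: Ns.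
  by rewrite sumrB sumr_const card_ord mulr_natl.
have H : d * (m%:R - d) < \sum_k s k * (s k + m%:R - r%:R - d).
  apply: schubert_codim_gt.
  - by rewrite /d ltr0n; lia.
  - by rewrite /d ltr_nat; lia.
  - by rewrite ltr0n.
  - by rewrite ltr_nat.
  - by rewrite -natrX -natrB ?(ltnW rm)// -!natrM ltr_nat.
  by move: NI; rewrite -(ler_nat int) !natrM sumN Id; lra.
rewrite -(ltr_nat int) natrD !natrM natr_sum Id -/d.
rewrite (eq_bigr (fun k => m%:R * r%:R - s k * (s k + m%:R - r%:R - d))); last first.
  by move=> k _; rewrite !natrD !natrM Ns -/d -/(s k); ring.
by rewrite sumrB sumr_const card_ord -[_ *+ n]mulr_natl; lra.
Qed.

(** There are finitely many pivot patterns. Each one that can come from an unstable tuple has a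
    nonzero polynomial vanishing on its image, and the product of these polynomials vanishes at all
    unstable tuples. *)
Lemma unstable_polyfun :
  (r < m)%N -> (0 < r)%N -> (m ^ 2 < n * (r * (m - r)))%N ->
  exists e (P : ('I_n * ('I_m * 'I_r) -> F) -> F),
    [/\ polyfun e P, exists x, P x != 0 &
        forall Y, ~ stable Y -> P (fun x => Y x.1 x.2.1 x.2.2) = 0].
Proof.
move=> rm r0 mn.
pose good (c : {set 'I_m} * {ffun 'I_n -> {set 'I_r}}) :=
  (0 < #|c.1| < m)%N && (m * \sum_k #|c.2 k| <= n * r * #|c.1|)%N.
have /choice[P PP] : forall c, exists P : ('I_n * ('I_m * 'I_r) -> F) -> F,
    ((exists e, polyfun e P) /\ exists x, P x != 0) /\
    (good c -> forall p, P (param_map c.1 c.2 p) = 0).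
  move=> c; have [/andP[c1 c2]|_] := boolP (good c); last first.
    (* Patterns that do not witness instability get the factor 1, which keeps the product
       nonzero. *)
    exists (fun=> 1); do 2 split => //; first by exists 0; exact: polyfun_cst.
    by exists (fun=> 0); exact: oner_neq0.
  have [e [P [pP P0 Pz]]] := polyfun_dependence_in
    (card_param_set_lt rm r0 mn c1 c2) (polyfun_param_map c.1 c.2)
    (@param_map_eq_in c.1 c.2).
  by exists P; do 2 split => //; exists e.
have [[e pe] Pn] := polyfun_prod_neq0 (index_enum _) (fun c => (PP c).1).
exists e, (fun x => \prod_c P c x); split=> // Y nY.
have [A rA] : exists A : 'M[F]_m, (0 < \rank A < m)%N /\
    (m * \sum_k \rank (A *m Y k) <= n * r * \rank A)%N.
  apply: contrapT => nA; apply: nY => A rA; rewrite ltnNge; apply/negP => A'.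
  by apply: nA; exists A.
have [I [N [p [cI cN <-]]]] := unstable_param_map Y A.
rewrite (bigD1 (I, N))//= (PP (I, N)).2 ?mul0r// /good /= cI rA.1 /=.
by under eq_bigr => k _ do rewrite cN; exact: rA.2.
Qed.

End unstable.

(** * Minors of maximal weight *)

Section cauchy_binet.
Context (F : comNzRingType) (m r : nat).

Lemma det_mulmx_sum (A : 'M[F]_(r, m)) (B : 'M[F]_(m, r)) :
  \det (A *m B) =
  \sum_(f : {ffun 'I_r -> 'I_m}) (\prod_i A i (f i)) * \det (rowsub f B).
Proof.
rewrite /determinant.
under eq_bigr => s _.
  under eq_bigr => i _ do rewrite mxE.
  rewrite bigA_distr_bigA mulr_sumr /=; over.
rewrite exchange_big; apply: eq_bigr => f _; rewrite mulr_sumr.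
apply: eq_bigr => s _; rewrite mulrCA big_split /=; congr (_ * (_ * _)).
by apply: eq_bigr => i _; rewrite mxE.
Qed.

(* Non-injective f contribute 0 and injective ones are counted once for each
   ordering of their range, whence the factor r!. *)
Lemma cauchy_binet (A : 'M[F]_(r, m)) (B : 'M[F]_(m, r)) :
  r`!%:R * \det (A *m B) =
  \sum_(f : {ffun 'I_r -> 'I_m}) \det (colsub f A) * \det (rowsub f B).
Proof.
transitivity (\sum_(s : 'S_r) \det (A *m B)).
  by rewrite sumr_const card_Sn mulr_natl.
transitivity (\sum_(s : 'S_r) \sum_(f : {ffun 'I_r -> 'I_m})
    (-1) ^+ s * (\prod_i colsub f A i (s i)) * \det (rowsub f B)); last first.
  by rewrite exchange_big; apply: eq_bigr => f _; rewrite mulr_suml.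
apply: eq_bigr => s _; rewrite det_mulmx_sum.
(* Composing f with s permutes the rows of the minor of [B], which produces the sign of s. *)
rewrite (reindex (fun f : {ffun 'I_r -> 'I_m} => [ffun i => f (s i)])) /=; last first.
  exists (fun f : {ffun 'I_r -> 'I_m} => [ffun i => f ((s^-1)%g i)]) => f _;
    by apply/ffunP => i; rewrite !ffunE ?permK ?permKV.
apply: eq_bigr => f _.
have -> : rowsub [ffun i => f (s i)] B = row_perm s (rowsub f B).
  by apply/matrixP => i j; rewrite !mxE ffunE.
rewrite row_permE det_mulmx det_perm mulrCA mulrA; congr (_ * _ * _).
by apply: eq_bigr => i _; rewrite !mxE ffunE.
Qed.

End cauchy_binet.

(* Abel summation: b is raised to the next value of a until a is constant. *)
Lemma sum_threshold_ge0 (R : realDomainType) (I : finType) (a c : I -> R) b :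
  (forall i, b <= a i) -> (forall t, 0 <= \sum_(i | t <= a i) c i) ->
  0 <= \sum_i (a i - b) * c i.
Proof.
have [n] := ubnP #|[set i | b < a i]|; elim: n a b => // n IH a b cn ab ac.
have [E0|[i0 bi0]] := set_0Vmem [set i | b < a i].
  rewrite big1// => i _; have /setP/(_ i) := E0; rewrite !inE lt_neqAle ab andbT.
  by move/negbFE/eqP => ->; rewrite subrr mul0r.
rewrite inE in bi0.
case: (@Order.TotalTheory.arg_minP _ _ _ i0 (fun i => b < a i) a bi0) => j bj jmin.
(* [a j] is the least value above [b], so [a'] differs from [a] only where a = b. Raising [b] to
   [a j] removes (a j - b) times a threshold sum and takes [j] out of the set b < a. *)
pose a' i := Num.max (a i) (a j).
have ai_le i : ~~ (a j <= a i) -> a i = b.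
  move=> ji; apply/eqP; rewrite eq_le ab andbT leNgt; apply: contra ji; exact: jmin.
have -> : \sum_i (a i - b) * c i =
    \sum_i (a' i - a j) * c i + (a j - b) * \sum_(i | a j <= a i) c i.
  rewrite [X in _ * X]big_mkcond mulr_sumr -big_split/=; apply: eq_bigr => i _.
  rewrite /a' /Num.max; case: (ltP (a i) (a j)) => ij.
    by rewrite (ai_le i) -?ltNge// !subrr !mul0r mulr0 addr0.
  by rewrite -mulrDl addrA subrK.
apply: addr_ge0; last by rewrite mulr_ge0// subr_ge0.
apply: IH => [|i|t].
- rewrite (leq_trans _ (ltnSE cn))//; apply: proper_card; apply/properP; split.
    apply/subsetP => i; rewrite !inE /a' lt_max ltxx orbF.
    exact: lt_trans.
  by exists j; rewrite inE// /a' maxxx ltxx.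
- by rewrite /a' le_max lexx orbT.
have [tj|tj] := leP t (a j).
  rewrite (eq_bigl (fun i => b <= a i)) => [|i]; first exact: ac.
  by rewrite ab /a' le_max tj orbT.
rewrite (eq_bigl (fun i => t <= a i)) => [|i]; first exact: ac.
by rewrite /a' le_max (leNgt t (a j)) tj orbF.
Qed.

Section weights.
Context (F : numFieldType) (R : realDomainType).

(** The matrix factors through a space of dimension [#|P|], and its compression to the coordinates
    in [P] is the identity. *)
Lemma rank_diag_bool n (P : pred 'I_n) :
  \rank (diag_mx (\row_i (P i)%:R) : 'M[F]_n) = #|P|.
Proof.
set D := diag_mx _; apply/eqP; rewrite eqn_leq; apply/andP; split.
  have -> : D = (\matrix_(i < n, j < #|P|) (i == enum_val j)%:R) *m
      (\matrix_(j < #|P|, i < n) (i == enum_val j)%:R).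
    apply/matrixP => i j; rewrite !mxE.
    have [Pi|Pi] := boolP (P i); last first.
      rewrite mul0rn big1// => l _; rewrite !mxE; case: eqP => [il|_]; last by rewrite mul0r.
      by move: Pi; rewrite il => /negP[]; exact: (enum_valP l).
    have Pi' : i \in P by [].
    rewrite (bigD1 (enum_rank_in Pi' i))//= big1 => [|l li].
      by rewrite !mxE enum_rankK_in// eqxx mul1r addr0 eq_sym.
    rewrite !mxE; case: eqP => [il|_]; last by rewrite mul0r.
    by case/eqP: li; apply: enum_val_inj; rewrite enum_rankK_in.
  exact: leq_trans (mxrankM_maxl _ _) (rank_leq_col _).
pose Q := (\matrix_(j < #|P|, i < n) (i == enum_val j)%:R) : 'M[F]_(#|P|, n).
have QD : Q *m D *m Q^T = 1%:M.
  apply/matrixP => i j; rewrite mul_mx_diag mxE (bigD1 (enum_val j))//= big1 => [|l lj].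
    rewrite addr0 !mxE eqxx mulr1 (inj_eq enum_val_inj).
    by have -> : P (enum_val j) = true := enum_valP j; rewrite mulr1 eq_sym.
  by rewrite !mxE (negPf lj) mulr0.
rewrite -{1}(mxrank1 F #|P|) -QD.
exact: leq_trans (mxrankM_maxl _ _) (mxrankM_maxr _ _).
Qed.

Context (m r : nat).

(* A minor of maximal weight: by the exchange property, the rows of weight at
   least t chosen by it span all the rows of weight at least t. *)
Lemma max_weight_minor (Y : 'M[F]_(m, r)) (a : 'I_m -> R) :
  row_full Y -> exists f : {ffun 'I_r -> 'I_m}, \det (rowsub f Y) != 0 /\
    forall t : R, (\rank (diag_mx (\row_l (t <= a l)%R%:R) *m Y) <=
      #|[pred i | (t <= a (f i))%R]|)%N.
Proof.
move=> fY; pose f0 := [ffun i => fullrankfun fY i].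
have f0P : \det (rowsub f0 Y) != 0.
  rewrite -unitfE -unitmxE (_ : rowsub f0 Y = rowsub (fullrankfun fY) Y) ?fullrowsub_unit//.
  by apply/matrixP => i j; rewrite !mxE ffunE.
case: (@Order.TotalTheory.arg_maxP _ _ _ f0
  (fun f : {ffun 'I_r -> 'I_m} => \det (rowsub f Y) != 0)
  (fun f => \sum_i a (f i)) f0P) => f fP fmax.
exists f; split=> // t; set M := rowsub f Y in fP.
have uM : M \in unitmx by rewrite unitmxE unitfE.
have [C YC] : exists C, Y = C *m M by exists (Y *m invmx M); rewrite mulmxKV.
(* Replacing row [f i] by row [l] multiplies the minor by the determinant of the identity with row i
   replaced by row l of [C]. It is nonzero when [C l i] is, so maximality of the weight applies. *)
have exchange l i : C l i != 0 -> a l <= a (f i).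
  move=> Cli; pose f' := [ffun j => if j == i then l else f j].
  have : \det (rowsub f' Y) != 0.
    pose E := \matrix_(j, j') (if j == i then C l j' else (j == j')%:R) : 'M[F]_r.
    have -> : rowsub f' Y = E *m M.
      apply/matrixP => j j'; rewrite mxE [RHS]mxE ffunE.
      have [ji|ji] := eqVneq j i.
        transitivity ((C *m M) l j'); first by rewrite -YC.
        by rewrite mxE; apply: eq_bigr => q _; rewrite [E j q]mxE ji eqxx.
      rewrite (bigD1 j)//= big1 => [|q qj]; rewrite [E j _]mxE (negPf ji).
        by rewrite eqxx mul1r addr0 mxE.
      by rewrite eq_sym (negPf qj) mul0r.
    rewrite det_mulmx mulf_neq0//; apply/det0P => -[v v0 vE].
    case/eqP: v0; apply/rowP => q; rewrite [RHS]mxE.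
    have vi : v 0 i = 0.
      have /rowP/(_ i) := vE; rewrite !mxE (bigD1 i)//= mxE eqxx big1 => [|j ji].
        by rewrite addr0 => /eqP; rewrite mulf_eq0 (negPf Cli) orbF => /eqP.
      by rewrite mxE (negPf ji) mulr0.
    have [->//|qi] := eqVneq q i.
    have /rowP/(_ q) := vE; rewrite !mxE (bigD1 q)//= mxE (negPf qi) eqxx mulr1 big1 ?addr0//.
    move=> j jq; rewrite mxE; case: eqP => [->|_]; first by rewrite vi mul0r.
    by rewrite (negPf jq) mulr0.
  move=> /fmax /=; rewrite (bigD1 i)//= [f' i]ffunE eqxx [X in _ <= X](bigD1 i)//=.
  rewrite (eq_bigr (fun j => a (f j))) => [|j ji]; first by rewrite lerD2r.
  by rewrite [f' j]ffunE (negPf ji).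
(* By the exchange property, a row of [C] whose weight is at least t is supported on the indices i
   with t <= a (f i), so a second selection can be inserted after [C]. *)
have -> : diag_mx (\row_l (t <= a l)%R%:R) *m Y =
    diag_mx (\row_l (t <= a l)%R%:R) *m C *m (diag_mx (\row_i (t <= a (f i))%R%:R) *m M).
  rewrite mulmxA {1}YC mulmxA; congr (_ *m _); apply/matrixP => l i.
  rewrite mul_diag_mx mul_mx_diag !mxE.
  have [tl|_] := leP t (a l); last by rewrite !mul0r.
  have [->|/exchange li] := eqVneq (C l i) 0; first by rewrite !mulr0 mul0r.
  by rewrite (le_trans tl li) mulr1.
apply: leq_trans (mxrankM_maxr _ _) _; apply: leq_trans (mxrankM_maxl _ _) _.
by rewrite rank_diag_bool; apply: eq_leq; apply: eq_card.
Qed.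

Context (n : nat).

(** Linear in a, the inequality follows by Abel summation from the threshold sets t <= a. For these,
    stability is a strict inequality between integers, and the gain of 1 becomes the term a p - a
    q. *)
Lemma stable_weights (X : 'I_n -> 'M[F]_(m, r)) (g : 'M[F]_m) (a : 'I_m -> R) :
  stable X -> (forall k, row_full (X k)) -> g \in unitmx ->
  exists f : 'I_n -> {ffun 'I_r -> 'I_m},
    (forall k, \det (rowsub (f k) (g *m X k)) != 0) /\
    forall p q, (n * r)%:R * \sum_l a l + (a p - a q) <=
      m%:R * \sum_k \sum_i a (f k i).
Proof.
move=> sX fX ug.
have /choice[f fP] : forall k, exists f : {ffun 'I_r -> 'I_m},
    \det (rowsub f (g *m X k)) != 0 /\
    forall t : R, (\rank (diag_mx (\row_l (t <= a l)%R%:R) *m (g *m X k)) <=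
      #|[pred i | (t <= a (f i))%R]|)%N.
  move=> k; apply: max_weight_minor.
  by rewrite /row_full eqmxMfull ?row_full_unit//; exact: fX.
exists f; split=> [k|p q]; first exact: (fP k).1.
pose N l := (\sum_k \sum_i (f k i == l))%N.
have sumN (h : 'I_m -> R) : \sum_l h l * (N l)%:R = \sum_k \sum_i h (f k i).
  under eq_bigr => l _ do rewrite natr_sum mulr_sumr.
  rewrite exchange_big; apply: eq_bigr => k _.
  under eq_bigr => l _ do rewrite natr_sum mulr_sumr.
  rewrite exchange_big; apply: eq_bigr => i _.
  rewrite (bigD1 (f k i))//= eqxx mulr1 big1 ?addr0// => l /negPf.
  by rewrite eq_sym => ->; rewrite mulr0.
(* With [N l] the number of times row l is chosen, the sum of a l times [c l] is the difference of
   the two sides of the claim. *)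
pose c l : R := m%:R * (N l)%:R - (n * r)%:R - (l == p)%:R + (l == q)%:R.
have sumc (h : 'I_m -> R) : \sum_l h l * c l =
    m%:R * (\sum_k \sum_i h (f k i)) - (n * r)%:R * (\sum_l h l) - h p + h q.
  rewrite -sumN (eq_bigr (fun l => m%:R * (h l * (N l)%:R) - (n * r)%:R * h l
    - h l * (l == p)%:R + h l * (l == q)%:R)) => [|l _]; last by rewrite /c; ring.
  rewrite big_split /= !sumrB -!mulr_sumr; congr (_ - _ + _).
    rewrite (bigD1 p)//= eqxx mulr1 big1 ?addr0// => l /negPf ->.
    by rewrite mulr0.
  by rewrite (bigD1 q)//= eqxx mulr1 big1 ?addr0// => l /negPf ->; rewrite mulr0.
have sumc0 : \sum_l c l = 0.
  transitivity (\sum_l 1 * c l); first by apply: eq_bigr => l _; rewrite mul1r.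
  rewrite sumc; under eq_bigr => k _ do rewrite sumr_const card_ord.
  by rewrite !sumr_const !card_ord natrM -mulr_natr; ring.
have cthr t : 0 <= \sum_(l | t <= a l) c l.
  have -> : \sum_(l | t <= a l) c l = \sum_l (t <= a l)%R%:R * c l.
    rewrite big_mkcond; apply: eq_bigr => l _.
    by case: ifP; rewrite ?mul1r ?mul0r.
  rewrite sumc.
  have -> : \sum_(l < m) (t <= a l)%R%:R = #|[pred l | t <= a l]|%:R :> R.
    by rewrite -sum1_card natr_sum [RHS]big_mkcond; apply: eq_bigr => l _; rewrite inE; case: ifP.
  have -> : \sum_k \sum_i (t <= a (f k i))%R%:R =
      (\sum_k #|[pred i | (t <= a (f k i))%R]|)%:R :> R.
    rewrite natr_sum; apply: eq_bigr => k _.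
    by rewrite -sum1_card natr_sum [RHS]big_mkcond; apply: eq_bigr => i _; rewrite inE; case: ifP.
  set s := #|[pred l | (t <= a l)%R]|; set T := (\sum_k _)%N.
  (* If all rows or no rows reach the threshold, the sum is exactly 0. The remaining thresholds give
     a matrix [A] of rank strictly between 0 and m, to which stability applies. *)
  have [/forallP ta|nall] := boolP [forall l, t <= a l].
    have -> : s = m by rewrite -[RHS]card_ord; apply: eq_card => l; rewrite !inE ta.
    have -> : T = (n * r)%N.
      rewrite /T (eq_bigr (fun=> r)) ?sum_nat_const ?card_ord// => k _.
      by rewrite -[RHS]card_ord; apply: eq_card => i; rewrite !inE ta.
    by rewrite (ta p) (ta q) subrK mulrC subrr.
  have [/existsP[l0 tl0]|nex] := boolP [exists l, t <= a l]; last first.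
    have ta l : (t <= a l) = false by apply: contraNF nex => tl; apply/existsP; exists l.
    have -> : s = 0 by apply: eq_card0 => l; rewrite !inE ta.
    have -> : T = 0.
      by rewrite /T big1// => k _; apply: eq_card0 => i; rewrite !inE ta.
    by rewrite (ta p) (ta q) !mulr0 !subr0 addr0.
  have sm : (0 < s < m)%N.
    apply/andP; split; first by apply/card_gt0P; exists l0.
    rewrite -[X in (_ < X)%N]card_ord; apply: proper_card; apply/properP.
    split; first exact/subsetP.
    by move: nall; rewrite negb_forall => /existsP[l tl]; exists l; rewrite // inE.
  pose A := diag_mx (\row_l (t <= a l)%R%:R) *m g.
  have rA : \rank A = s by rewrite mxrankMfree ?row_free_unit// rank_diag_bool.
  have := sX A; rewrite rA => /(_ sm) lt.
  have : (n * r * s < m * T)%N.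
    apply: leq_trans lt _; rewrite leq_mul2l; apply/orP; right.
    by apply: leq_sum => k _; rewrite -mulmxA; exact: (fP k).2.
  (* The strict inequality is used as n r s + 1 <= m T; the 1 compensates the term -1 that appears
     when t <= a p. *)
  rewrite -addn1 -(ler_nat R) natrD [(_ * s)%:R]natrM [(m * T)%:R]natrM => H.
  have b1 : (t <= a p)%R%:R <= 1 :> R by case: (t <= a p).
  have b2 : 0 <= (t <= a q)%R%:R :> R by case: (t <= a q).
  by apply: addr_ge0 => //; rewrite subr_ge0 (le_trans b1)// lerBrDl.
(* Abel summation starts from the minimum of [a]; since the coefficients [c] sum to 0, subtracting
   the constant [b] leaves the weighted sum unchanged. *)
pose b := a [arg min_(i < p) a i]%O.
have bP i : b <= a i by rewrite /b; case: arg_minP => // j _ ; apply.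
have := sum_threshold_ge0 bP cthr.
rewrite (eq_bigr (fun i => a i * c i - b * c i)) => [|i _]; last by rewrite mulrBl.
rewrite sumrB -mulr_sumr sumc0 mulr0 subr0 sumc => H.
by rewrite -subr_ge0 opprD opprB addrA (addrC (a q)) addrA.
Qed.

End weights.

From mathcomp Require Import complex spectral.
From mathcomp Require Import all_classical all_reals all_analysis.
Import numFieldNormedType.Exports.
Local Open Scope classical_set_scope.
Local Open Scope ring_scope.

(** * The ground field *)

Section ground_theory.
Context (R : realType) (k : base_field).
Local Notation F := (ground R k).
Local Notation re := (@ground_re R k).
Local Notation conj := (@ground_conj R k).

Definition ground_im : F -> R :=
  match k return ground R k -> R with
  | RealNumbers => fun=> 0
  | ComplexNumbers => @complex.Im R
  end.

Definition ground_of_real : {rmorphism R -> F} :=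
  match k return (let G : numFieldType :=
      match k with RealNumbers => R | ComplexNumbers => R[i] end in
    {rmorphism R -> G}) with
  | RealNumbers => idfun
  | ComplexNumbers => real_complex R
  end.
Local Notation im := ground_im.
Local Notation iota := ground_of_real.

Lemma ground_eqP (z w : F) : re z = re w -> im z = im w -> z = w.
Proof. by rewrite /ground_re /ground_im; case: k z w => //= -[a b] [c d] /= -> ->. Qed.

Lemma ground_reD z w : re (z + w) = re z + re w.
Proof. by rewrite /ground_re; case: k z w => //= -[a b] [c d]. Qed.

Lemma ground_imD z w : im (z + w) = im z + im w.
Proof. by rewrite /ground_im; case: k z w => //= [*|[a b] [c d]//]; rewrite addr0. Qed.

Lemma ground_reM z w : re (z * w) = re z * re w - im z * im w.
Proof.
rewrite /ground_re /ground_im; case: k z w => //= [z w|[a b] [c d]//].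
by rewrite mulr0 subr0.
Qed.

Lemma ground_imM z w : im (z * w) = re z * im w + im z * re w.
Proof.
rewrite /ground_re /ground_im; case: k z w => //= [z w|[a b] [c d]//].
by rewrite mulr0 mul0r addr0.
Qed.

Lemma ground_re_conj z : re (conj z) = re z.
Proof. by rewrite /ground_re /ground_conj; case: k z => //= -[a b]. Qed.

Lemma ground_im_conj z : im (conj z) = - im z.
Proof. by rewrite /ground_im /ground_conj; case: k z => //= [_|[a b]//]; rewrite oppr0. Qed.

Lemma ground_re_real x : re (iota x) = x.
Proof. by rewrite /ground_re /ground_of_real; case: k. Qed.

Lemma ground_im_real x : im (iota x) = 0.
Proof. by rewrite /ground_im /ground_of_real; case: k. Qed.

Lemma ground_gt0 z : (0 < z) = (im z == 0) && (0 < re z).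
Proof.
rewrite /ground_re /ground_im; case: k z => //= [z|[a b]]; first by rewrite eqxx.
by rewrite ltcE.
Qed.

Lemma ground_re_nat n : re n%:R = n%:R.
Proof. by rewrite -(rmorph_nat iota) ground_re_real. Qed.

Lemma ground_re0 : re 0 = 0. Proof. exact: (ground_re_nat 0). Qed.

Lemma ground_im0 : im 0 = 0.
Proof. by rewrite -(rmorph0 iota) ground_im_real. Qed.

Lemma ground_im1 : im 1 = 0.
Proof. by rewrite -(rmorph1 iota) ground_im_real. Qed.

Lemma ground_conjK z : conj (conj z) = z.
Proof.
by apply: ground_eqP; rewrite ?ground_re_conj// !ground_im_conj opprK.
Qed.

Lemma ground_conj_real x : conj (iota x) = iota x.
Proof.
by apply: ground_eqP; rewrite ?ground_re_conj// ground_im_conj ground_im_real oppr0.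
Qed.

Lemma ground_realP z : conj z = z -> z = iota (re z).
Proof.
move=> /(congr1 im); rewrite ground_im_conj => imz.
by apply: ground_eqP; rewrite ?ground_re_real// ground_im_real; lra.
Qed.

Lemma ground_real_gt0 x : (0 < iota x) = (0 < x).
Proof. by rewrite ground_gt0 ground_im_real ground_re_real eqxx. Qed.

Lemma ground_real_inj : injective iota. Proof. exact: fmorph_inj. Qed.

Definition ground_normsq z := re z ^+ 2 + im z ^+ 2.
Local Notation nsq := ground_normsq.

Lemma ground_conj_mul z : conj z * z = iota (nsq z).
Proof.
apply: ground_eqP; rewrite ?(ground_reM, ground_imM) ground_re_conj ground_im_conj.
  by rewrite ground_re_real /ground_normsq; ring.
by rewrite ground_im_real; ring.
Qed.

Lemma ground_normsq_ge0 z : 0 <= nsq z.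
Proof. by rewrite addr_ge0// sqr_ge0. Qed.

Lemma ground_normsq_eq0 z : (nsq z == 0) = (z == 0).
Proof.
apply/eqP/eqP => [|->]; last by rewrite /ground_normsq ground_re0 ground_im0 expr0n addr0.
move=> /eqP; rewrite paddr_eq0 ?sqr_ge0// !sqrf_eq0 => /andP[/eqP rz /eqP iz].
by apply: ground_eqP; rewrite ?ground_re0 ?ground_im0.
Qed.

Lemma ground_normsq_gt0 z : (0 < nsq z) = (z != 0).
Proof. by rewrite lt_neqAle ground_normsq_ge0 andbT eq_sym ground_normsq_eq0. Qed.

Lemma ground_invE z : z^-1 = iota (nsq z)^-1 * conj z.
Proof.
have [->|z0] := eqVneq z 0; first by rewrite rmorph0 mulr0 invr0.
apply: (mulIf z0); rewrite mulVf// -mulrA ground_conj_mul -rmorphM mulVf ?rmorph1//.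
by rewrite ground_normsq_eq0.
Qed.

Section ground_function.
(* A is used for the measurable functions and for the continuous ones. *)
Context (T : Type) (A : (T -> R) -> Prop).
Hypothesis Acst : forall c, A (fun=> c).
Hypothesis Aadd : forall f g, A f -> A g -> A (fun t => f t + g t).
Hypothesis Amul : forall f g, A f -> A g -> A (fun t => f t * g t).

Definition groundfun (f : T -> F) := A (fun t => re (f t)) /\ A (fun t => im (f t)).

Lemma groundfun_eq f g : f =1 g -> groundfun f -> groundfun g.
Proof. by move=> /funext ->. Qed.

Let A_eq f g : f =1 g -> A f -> A g. Proof. by move=> /funext ->. Qed.

Let Aopp f : A f -> A (fun t => - f t).
Proof. by move=> Af; apply: A_eq (Amul (Acst (-1)) Af) => t; rewrite mulN1r. Qed.

Lemma groundfun_cst c : groundfun (fun=> c).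
Proof. by split; exact: Acst. Qed.

Lemma groundfun_add f g :
  groundfun f -> groundfun g -> groundfun (fun t => f t + g t).
Proof.
move=> [rf mf] [rg mg]; split.
  by apply: A_eq (Aadd rf rg) => t; rewrite ground_reD.
by apply: A_eq (Aadd mf mg) => t; rewrite ground_imD.
Qed.

Lemma groundfun_mul f g :
  groundfun f -> groundfun g -> groundfun (fun t => f t * g t).
Proof.
move=> [rf mf] [rg mg]; split.
  by apply: A_eq (Aadd (Amul rf rg) (Aopp (Amul mf mg))) => t; rewrite ground_reM.
by apply: A_eq (Aadd (Amul rf mg) (Amul mf rg)) => t; rewrite ground_imM.
Qed.

Lemma groundfun_conj f : groundfun f -> groundfun (fun t => conj (f t)).
Proof.
move=> [rf mf]; split; first by apply: A_eq rf => t; rewrite ground_re_conj.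
by apply: A_eq (Aopp mf) => t; rewrite ground_im_conj.
Qed.

Lemma groundfun_real f : A f -> groundfun (fun t => iota (f t)).
Proof.
move=> Af; split; first by apply: A_eq Af => t; rewrite ground_re_real.
by apply: A_eq (Acst 0) => t; rewrite ground_im_real.
Qed.

Lemma groundfun_normsq f : groundfun f -> A (fun t => nsq (f t)).
Proof. by move=> [rf mf]; exact: Aadd (Amul rf rf) (Amul mf mf). Qed.

Lemma groundfun_sum I (s : seq I) (P : pred I) (f : I -> T -> F) :
  (forall i, groundfun (f i)) -> groundfun (fun t => \sum_(i <- s | P i) f i t).
Proof.
move=> gf; elim: s => [|i s IH].
  by apply: groundfun_eq (groundfun_cst 0) => t; rewrite big_nil.
have [Pi|Pi] := boolP (P i); last first.
  by apply: groundfun_eq IH => t; rewrite big_cons (negPf Pi).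
by apply: groundfun_eq (groundfun_add (gf i) IH) => t; rewrite big_cons Pi.
Qed.

Lemma groundfun_prod I (s : seq I) (P : pred I) (f : I -> T -> F) :
  (forall i, groundfun (f i)) -> groundfun (fun t => \prod_(i <- s | P i) f i t).
Proof.
move=> gf; elim: s => [|i s IH].
  by apply: groundfun_eq (groundfun_cst 1) => t; rewrite big_nil.
have [Pi|Pi] := boolP (P i); last first.
  by apply: groundfun_eq IH => t; rewrite big_cons (negPf Pi).
by apply: groundfun_eq (groundfun_mul (gf i) IH) => t; rewrite big_cons Pi.
Qed.

Definition groundfun_mx m n (M : T -> 'M[F]_(m, n)) :=
  forall i j, groundfun (fun t => M t i j).

Lemma groundfun_mulmx m n p (M : T -> 'M[F]_(m, n)) (N : T -> 'M[F]_(n, p)) :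
  groundfun_mx M -> groundfun_mx N -> groundfun_mx (fun t => M t *m N t).
Proof.
move=> gM gN i j; apply: (@groundfun_eq (fun t => \sum_l M t i l * N t l j)).
  by move=> t; rewrite mxE.
by apply: groundfun_sum => l; exact: groundfun_mul.
Qed.

Lemma groundfun_adjmx m n (M : T -> 'M[F]_(m, n)) :
  groundfun_mx M -> groundfun_mx (fun t => adjmx (M t)).
Proof.
move=> gM i j; apply: groundfun_eq (groundfun_conj (gM j i)) => t.
by rewrite !mxE.
Qed.

Lemma groundfun_det n (M : T -> 'M[F]_n) :
  groundfun_mx M -> groundfun (fun t => \det (M t)).
Proof.
move=> gM; rewrite /determinant; apply: groundfun_sum => s.
by apply: groundfun_mul; [exact: groundfun_cst|exact: groundfun_prod].
Qed.

Lemma groundfun_polyfun I d (P : (I -> F) -> F) (f : T -> I -> F) :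
  polyfun d P -> (forall i, groundfun (fun t => f t i)) ->
  groundfun (fun t => P (f t)).
Proof.
move=> pP gf; elim: pP => {d P}.
- by move=> d c; exact: groundfun_cst.
- by move=> d i; exact: gf.
- by move=> d P Q _ IHP _ IHQ; exact: groundfun_add.
by move=> d e P Q _ IHP _ IHQ; exact: groundfun_mul.
Qed.

(** Since 1/z = conj z / |z|^2, inverses of nonnegative real functions suffice; the formula is also
    valid at 0, where inverses are 0. *)
Lemma groundfun_inv f : (forall g, (forall t, 0 <= g t) -> A g -> A (fun t => (g t)^-1)) ->
  groundfun f -> groundfun (fun t => (f t)^-1).
Proof.
move=> Ainv gf.
apply: (@groundfun_eq (fun t => iota (nsq (f t))^-1 * conj (f t))).
  by move=> t; rewrite ground_invE.
apply: groundfun_mul; last exact: groundfun_conj.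
apply: groundfun_real; apply: Ainv; last exact: groundfun_normsq.
by move=> t; exact: ground_normsq_ge0.
Qed.

End ground_function.

End ground_theory.

(** * Null sets of polynomial functions *)

Section measurable_ground.
Context (R : realType) (k : base_field).
Local Notation F := (ground R k).

Definition mground d (T : measurableType d) (f : T -> F) :=
  groundfun (fun g : T -> R => measurable_fun setT g) f.

Section closure.
Context d (T : measurableType d).

Lemma measurable_fun_cstR (c : R) : measurable_fun [set: T] (fun=> c).
Proof. exact: measurable_cst. Qed.

Lemma measurable_fun_addR (f g : T -> R) : measurable_fun setT f ->
  measurable_fun setT g -> measurable_fun setT (fun t => f t + g t).
Proof. exact: measurable_realfun.measurable_funD. Qed.

Lemma measurable_fun_mulR (f g : T -> R) : measurable_fun setT f ->
  measurable_fun setT g -> measurable_fun setT (fun t => f t * g t).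
Proof. exact: measurable_realfun.measurable_funM. Qed.

(** On nonnegative reals the inverse is the real power with exponent -1, which is measurable. *)
Lemma measurable_fun_invR (g : T -> R) : (forall t, 0 <= g t) ->
  measurable_fun setT g -> measurable_fun setT (fun t => (g t)^-1).
Proof.
move=> g0 mg; rewrite (_ : (fun t => _) = (fun x : R => x `^ (-1)) \o g).
  exact: measurableT_comp.
by apply/funext => t /=; rewrite powR_inv1.
Qed.

Lemma measurable_mground_eq0 (f : T -> F) : mground f -> measurable [set t | f t = 0].
Proof.
move=> [rf mf]; rewrite (_ : mkset _ = (fun t => ground_re (f t)) @^-1` [set 0] `&`
    (fun t => ground_im (f t)) @^-1` [set 0]).
  apply: measurableI; rewrite -[X in measurable X]setTI.
    exact: (rf measurableT _ (measurable_set1 _)).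
  exact: (mf measurableT _ (measurable_set1 _)).
apply/seteqP; split => t /=; first by move=> ->; rewrite ground_re0 ground_im0.
by move=> [rt it]; apply: ground_eqP; rewrite ?ground_re0 ?ground_im0.
Qed.

Lemma mground_comp d' (S : measurableType d') (u : S -> T) (f : T -> F) :
  measurable_fun setT u -> mground f -> mground (f \o u).
Proof.
move=> mu [rf mf].
by split; [exact: (measurableT_comp rf mu)|exact: (measurableT_comp mf mu)].
Qed.

End closure.

Lemma mground_polyfun d (T : measurableType d) I e (P : (I -> F) -> F)
    (f : T -> I -> F) :
  polyfun e P -> (forall i, mground (fun t => f t i)) -> mground (fun t => P (f t)).
Proof.
apply: groundfun_polyfun;
  [exact: measurable_fun_cstR|exact: measurable_fun_addR|exact: measurable_fun_mulR].
Qed.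

End measurable_ground.

Section poly_null.
Context (R : realType) (k : base_field).
Local Notation F := (ground R k).

(* Each point t carries the countable family [h g t] of vectors of F^I: a
   nonzero polynomial function vanishes on the whole family for almost no t. *)
Definition poly_null d (T : measurableType d) (mu : probability T R) (I : Type)
    (G : countType) (h : G -> T -> I -> F) :=
  (forall g i, mground (fun t => h g t i)) /\
  forall e (P : (I -> F) -> F), polyfun e P -> (exists x, P x != 0) ->
    mu [set t | forall g, P (h g t) = 0] = 0%E.

(** Countability of [G] turns the set into a countable intersection of zero sets, indexed by natural
    numbers through [unpickle]. *)
Lemma measurable_poly_zeros d (T : measurableType d) (I : Type) (G : countType)
    (h : G -> T -> I -> F) e (P : (I -> F) -> F) :
  (forall g i, mground (fun t => h g t i)) -> polyfun e P ->
  measurable [set t | forall g, P (h g t) = 0].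
Proof.
move=> mh pP; rewrite (_ : mkset _ = \bigcap_(n in setT)
    [set t | if unpickle n is Some g then P (h g t) = 0 else True]).
  apply: bigcap_measurableType => n _.
  case: unpickle => [g|]; last exact: measurableT.
  by apply: measurable_mground_eq0; apply: mground_polyfun pP _ => i; exact: mh.
apply/seteqP; split => t /=.
  by move=> Pt n _ /=; case: unpickle.
by move=> Pt g; have := Pt (pickle g) Logic.I; rewrite /= pickleK.
Qed.

(** The product measure of [A] is the integral of the measures of its sections, and these vanish
    outside the null set [N]. *)
Lemma product_null d1 d2 (T1 : measurableType d1) (T2 : measurableType d2)
    (mu1 : probability T1 R) (mu2 : probability T2 R) (A : set (T1 * T2))
    (N : set T1) :
  measurable A -> measurable N -> mu1 N = 0%E ->
  (forall t1, ~ N t1 -> mu2 (xsection A t1) = 0%E) -> (mu1 \x mu2)%E A = 0%E.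
Proof.
move=> mA mN N0 A0; rewrite /product_measure1.
rewrite (ge0_negligible_integral mN)//; last exact: measurable_fun_xsection.
by apply: integral0_eq => t [_ Nt]; exact: A0.
Qed.

Definition sum_point (I1 I2 : Type) (x : I1 -> F) (y : I2 -> F) (i : I1 + I2) :=
  match i with inl a => x a | inr b => y b end.

(** Let P be nonzero at (z1, z2). For almost all t1 some point x = h1 g1 t1 satisfies P(x, z2) != 0.
    Then P(x, .) is a nonzero polynomial function, so the section of the zero set at t1 is null. *)
Lemma poly_null_prod d1 d2 (T1 : measurableType d1) (T2 : measurableType d2)
    (mu1 : probability T1 R) (mu2 : probability T2 R) (I1 I2 : Type)
    (G1 G2 : countType) (h1 : G1 -> T1 -> I1 -> F) (h2 : G2 -> T2 -> I2 -> F) :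
  poly_null mu1 h1 -> poly_null mu2 h2 ->
  poly_null (mu1 \x mu2)%E (fun (g : G1 * G2) (t : T1 * T2) =>
    sum_point (h1 g.1 t.1) (h2 g.2 t.2)).
Proof.
move=> [mh1 n1] [mh2 n2].
have mh (g : G1 * G2) i : mground (fun t : T1 * T2 =>
    sum_point (h1 g.1 t.1) (h2 g.2 t.2) i).
  case: i => i /=.
    exact: (mground_comp measurable_fst (mh1 g.1 i)).
  exact: (mground_comp measurable_snd (mh2 g.2 i)).
split=> // e P pP [z Pz].
have pPl y : polyfun (e * 1) (fun x : I1 -> F => P (sum_point x y)).
  apply: polyfun_comp pP _ => -[a|b]; [exact: (@polyfun_var _ _ 0 a)|exact: polyfun_cst].
have pPr x : polyfun (e * 1) (fun y : I2 -> F => P (sum_point x y)).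
  apply: polyfun_comp pP _ => -[a|b]; [exact: polyfun_cst|exact: (@polyfun_var _ _ 0 b)].
have Pz' : P (sum_point (z \o inl) (z \o inr)) != 0.
  by move: Pz; congr (P _ != 0); apply/funext => -[].
apply: (product_null (measurable_poly_zeros mh pP)).
- exact: measurable_poly_zeros mh1 (pPl (z \o inr)).
- by apply: n1 (pPl (z \o inr)) _; exists (z \o inl).
move=> t1 /= /existsNP[g1 /eqP Pg1].
have := n2 _ _ (pPr (h1 g1 t1)) (ex_intro _ (z \o inr) Pg1).
move=> n0; apply/eqP; rewrite eq_le measure_ge0 andbT -n0 le_measure ?inE//.
- by apply: measurable_xsection; exact: (measurable_poly_zeros mh pP).
- exact: measurable_poly_zeros mh2 (pPr _).
by move=> t2; rewrite xsectionE /= => A g2; exact: (A (g1, g2)).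
Qed.

Lemma poly_null_power d (T : measurableType d) (mu : probability T R) (I : Type)
    (G : countType) (h : G -> T -> I -> F) n : poly_null mu h ->
  poly_null (power_prob mu n) (fun (g : n.-tuple G) (t : n.-tuple T) (i : 'I_n * I) =>
    h (tnth g i.1) (tnth t i.1) i.2).
Proof.
move=> nh; have mh m (g : m.-tuple G) (i : 'I_m * I) :
    mground (fun t : m.-tuple T => h (tnth g i.1) (tnth t i.1) i.2).
  exact: (mground_comp (measurable_tnth i.1) (nh.1 (tnth g i.1) i.2)).
split=> [|e P pP [z Pz]]; first exact: mh.
elim: n e P pP z Pz => [|n IH] e P pP z Pz.
  (* For n = 0 there are no coordinates, so all points coincide and the nonzero function P has no
     zeros. *)
  rewrite (_ : mkset _ = set0) ?measure0//; apply/seteqP; split => // t /=.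
  move=> /(_ [tuple])/eqP; apply/negP; move: Pz; congr (P _ != 0).
  by apply/funext => -[[]].
(* [join] identifies the coordinates of n + 1 factors with those of the first factor and of the n
   others. *)
pose join (x : I + 'I_n * I -> F) (i : 'I_n.+1 * I) : F :=
  if unlift ord0 i.1 is Some j then x (inr (j, i.2)) else x (inl i.2).
have nn : poly_null (power_prob mu n) (fun (g : n.-tuple G) (t : n.-tuple T)
    (i : 'I_n * I) => h (tnth g i.1) (tnth t i.1) i.2).
  by split=> [|e' Q pQ [y Qy]]; [exact: mh|exact: IH pQ _ Qy].
have H := (poly_null_prod nh nn).2 (e * 1)%N (fun x => P (join x)).
rewrite /= /distribution /pushforward -[RHS]H.
- congr (_ _); apply/seteqP; split => -[t1 t] /= Pt.
    move=> [g1 g]; have := Pt [tuple of g1 :: g]; congr (P _ = 0).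
    apply/funext => -[i a]; rewrite /join /=; case: unliftP => [j|] -> /=.
      by rewrite !tnthS.
    by rewrite !tnth0.
  move=> g; have := Pt (thead g, [tuple of behead g]); congr (P _ = 0).
  apply/funext => -[i a]; rewrite /join /=; case: unliftP => [j|] -> /=.
    by rewrite tnthS tnth_behead; congr (h (tnth _ _)); apply/val_inj; rewrite /= inordK// ltnS.
  by rewrite tnth0.
- apply: polyfun_comp pP _ => -[i a]; rewrite /join /=.
  case: unliftP => [j|] _; first exact: (@polyfun_var _ _ 0 (inr (j, a))).
  exact: (@polyfun_var _ _ 0 (inl a)).
exists (fun i => match i with inl a => z (ord0, a) | inr ja => z (lift ord0 ja.1, ja.2) end).
move: Pz; congr (P _ != 0); apply/funext => -[i a]; rewrite /join /=.
by case: unliftP => [j|] ->.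
Qed.

End poly_null.

Lemma poly_roots_seq (F : fieldType) (p : {poly F}) : p != 0 ->
  exists s : seq F, forall z, root p z -> z \in s.
Proof.
have [n] := ubnP (size p); elim: n p => // n IH p sp p0.
have [[z pz]|noroot] := pselect (exists z, root p z); last first.
  by exists [::] => z pz; case: noroot; exists z.
have /factor_theorem[q pq] := pz; rewrite pq mulf_eq0 negb_or in p0.
have /andP[q0 _] := p0; have [|s sq] := IH q _ q0.
  by move: sp; rewrite pq size_Mmonic ?monicXsubC// size_XsubC addn2.
exists (z :: s) => w; rewrite pq rootM root_XsubC inE => /orP[/sq ->|->//].
by rewrite orbT.
Qed.

Section normal_null.
Context (R : realType) (k : base_field).
Local Notation F := (ground R k).
Local Notation mu := (normal_prob 0 (Num.sqrt (real_dim k)%:R^-1)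
  : probability (measurableTypeR R) R).

Lemma real_dim_gt0 : (0 < real_dim k)%N. Proof. by case: k. Qed.

Lemma ground_re_of_coords (t : (real_dim k).-tuple R) :
  ground_re (of_coords t) = tnth t (Ordinal real_dim_gt0).
Proof.
by rewrite (tnth_nth 0) /= /ground_re /of_coords; case: k t.
Qed.

Lemma mground_of_coords :
  mground (@of_coords R k : (real_dim k).-tuple (measurableTypeR R) -> F).
Proof.
split.
  rewrite (_ : (fun t => _) = (fun t => tnth t (Ordinal real_dim_gt0))).
    exact: measurable_tnth.
  by apply/funext => t; rewrite ground_re_of_coords.
rewrite /ground_im /of_coords; case: k => /=; first exact: measurable_cst.
rewrite (_ : (fun t => _) = (fun t => tnth t (@Ordinal 2 1 isT))).
  exact: measurable_tnth.
by apply/funext => t; rewrite (tnth_nth 0).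
Qed.

(** A nonzero polynomial in one variable has finitely many roots z, and the event of hitting z is
    contained in the event that the real part equals that of z. The latter is null because normal
    distributions have no atoms. *)
Lemma poly_null_coords :
  poly_null (power_prob mu (real_dim k))
    (fun (_ : unit) (t : (real_dim k).-tuple (measurableTypeR R)) (_ : unit) =>
       (of_coords t : F)).
Proof.
split=> [_ _|e P pP [x Px]]; first exact: mground_of_coords.
have [p _ pE] := polyfun_line (fun=> 0) (fun=> 1) pP.
have P1 z : P (fun=> z) = p.[z].
  by rewrite -pE; congr P; apply/funext => i; rewrite add0r mulr1.
have p0 : p != 0.
  apply: contraNneq Px => p0; rewrite (_ : x = fun=> x tt); last first.
    by apply/funext => -[].
  by rewrite P1 p0 horner0.
have [s sP] := poly_roots_seq p0.
pose i0 := Ordinal real_dim_gt0.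
(* Only the first real coordinate, the real part, is constrained. *)
pose A (z : F) i : set (measurableTypeR R) :=
  if i == i0 then [set ground_re z] else setT.
have mA z i : measurable (A z i).
  by rewrite /A; case: ifP => _; [exact: measurable_set1|exact: measurableT].
pose B (z : F) := [set t : (real_dim k).-tuple (measurableTypeR R) |
  forall i, A z i (tnth t i)].
have mB z : measurable (B z) := measurable_box (mA z).
have B0 z : power_prob mu (real_dim k) (B z) = 0%E.
  have -> : power_prob mu (real_dim k) (B z) = _ := power_prob_box mu (mA z).
  rewrite (bigD1 i0)//= {1}/A eqxx.
  have -> : normal_prob 0 (Num.sqrt (real_dim k)%:R^-1) [set ground_re z] = 0%E.
    have /null_content_dominatesP := normal_prob_dominates 0 (Num.sqrt (real_dim k)%:R^-1) (R := R).
    by apply; [exact: measurable_set1|exact: lebesgue_measure_set1].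
  by rewrite mul0e.
apply/eqP; rewrite eq_le measure_ge0 andbT.
have mU : measurable (\big[setU/set0]_(z <- s) B z) by exact: bigsetU_measurable.
apply: (@le_trans _ _ (power_prob mu (real_dim k) (\big[setU/set0]_(z <- s) B z))).
  apply: le_measure; rewrite ?inE//.
    apply: measurable_poly_zeros pP => _ _; exact: mground_of_coords.
  move=> t /= /(_ tt); rewrite P1 => /rootP/sP; rewrite -bigcup_seq => zs.
  exists (of_coords t) => // i; rewrite /A; case: eqP => // ->.
  by rewrite /= ground_re_of_coords.
rewrite le_eqVlt; apply/orP; left; apply/eqP; elim: (s) => [|z s' IH].
  by rewrite big_nil measure0.
by rewrite big_cons setUC measureU0 ?IH//; [exact: bigsetU_measurable|exact: B0].
Qed.

Context (m r : nat).

Lemma poly_null_frame :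
  poly_null (normal_frame_prob R k m r)
    (fun (_ : r.-tuple (m.-tuple unit)) (w : coord_space R k m r)
         (i : 'I_r * ('I_m * unit)) => (of_coords (tnth (tnth w i.1) i.2.1) : F)).
Proof.
exact: (poly_null_power r (poly_null_power m poly_null_coords)).
Qed.

End normal_null.

(** * Random subspaces *)

Section gram.
Context (R : realType) (k : base_field).
Local Notation F := (ground R k).

Lemma adjmxK m n (A : 'M[F]_(m, n)) : adjmx (adjmx A) = A.
Proof. by apply/matrixP => i j; rewrite !mxE ground_conjK. Qed.

Lemma adjmx1 n : adjmx (1%:M : 'M[F]_n) = 1%:M.
Proof. by apply/matrixP => i j; rewrite !mxE eq_sym rmorph_nat. Qed.

Lemma det_adjmx n (A : 'M[F]_n) : \det (adjmx A) = ground_conj R k (\det A).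
Proof. by rewrite /adjmx det_map_mx det_tr. Qed.

Lemma adjmx_mulE n (x : 'cV[F]_n) :
  (adjmx x *m x) 0 0 = ground_of_real R k (\sum_i ground_normsq (x i 0)).
Proof.
rewrite mxE rmorph_sum; apply: eq_bigr => i _.
by rewrite !mxE ground_conj_mul.
Qed.

Lemma adjmx_mul_eq0 n (x : 'cV[F]_n) : adjmx x *m x = 0 -> x = 0.
Proof.
move=> /matrixP/(_ 0 0); rewrite adjmx_mulE mxE -(rmorph0 (ground_of_real R k)).
move=> /ground_real_inj /eqP; rewrite psumr_eq0 => [/allP x0|i _]; last first.
  exact: ground_normsq_ge0.
apply/colP => i; rewrite [RHS]mxE; apply/eqP; rewrite -ground_normsq_eq0.
exact: x0.
Qed.

Definition full_col_rank m n (X : 'M[F]_(m, n)) := forall x : 'cV_n, X *m x = 0 -> x = 0.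

Lemma unitmx_full_col_rank n (A : 'M[F]_n) : A \in unitmx <-> full_col_rank A.
Proof.
split=> [uA x Ax|A0]; first by rewrite -[x](mulKmx uA) Ax mulmx0.
rewrite -unitmx_tr -row_free_unit -kermx_eq0; apply/rowV0P => v /sub_kermxP vA.
apply: trmx_inj; rewrite trmx0; apply: A0.
by rewrite -[A]trmxK -trmx_mul vA trmx0.
Qed.

Lemma gram_unit m n (X : 'M[F]_(m, n)) : adjmx X *m X \in unitmx <-> full_col_rank X.
Proof.
split=> [/unitmx_full_col_rank uX x Xx|X0].
  by apply: uX; rewrite -mulmxA Xx mulmx0.
apply/unitmx_full_col_rank => x XXx; apply: X0; apply: adjmx_mul_eq0.
by rewrite adjmxM -mulmxA [adjmx X *m _]mulmxA XXx mulmx0.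
Qed.

(** The orthogonal projection onto the range of [X], provided that [X] has independent columns. *)
Definition range_proj m n (X : 'M[F]_(m, n)) : 'M[F]_m :=
  X *m invmx (adjmx X *m X) *m adjmx X.

Lemma range_proj_mul m n (X : 'M[F]_(m, n)) (P : 'M[F]_n) :
  full_col_rank X -> P \in unitmx -> range_proj (X *m P) = range_proj X.
Proof.
move=> /gram_unit uX uP.
have uPa : adjmx P \in unitmx by rewrite unitmxE det_adjmx unitfE fmorph_eq0 -unitfE -unitmxE.
have E : adjmx (X *m P) *m (X *m P) = adjmx P *m (adjmx X *m X) *m P.
  by rewrite adjmxM !mulmxA.
rewrite /range_proj E adjmxM.
have -> : invmx (adjmx P *m (adjmx X *m X) *m P) =
    invmx P *m invmx (adjmx X *m X) *m invmx (adjmx P).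
  move: (adjmx X *m X) uX => G uX.
  apply: (row_free_inj (A := adjmx P *m G *m P)).
    by rewrite row_free_unit !unitmx_mul uPa uX.
  rewrite mulVmx ?unitmx_mul ?uPa ?uX//.
  by rewrite -!mulmxA (mulKmx uPa) (mulKmx uX) mulVmx.
by rewrite !mulmxA mulmxK// mulmxKV.
Qed.

Lemma range_proj_id m n (X : 'M[F]_(m, n)) : full_col_rank X -> range_proj X *m X = X.
Proof. by move=> /gram_unit uX; rewrite /range_proj -mulmxA mulmxKV. Qed.

End gram.

Section grassmannian_projection.
Context (R : realType) (k : base_field) (m r : nat) (rm : (r < m)%N).
Local Notation F := (ground R k).
Local Notation V := 'cV[F]_m.
Local Notation Gr := (grassmannian R k rm).

Definition cols_mx n (s : n.-tuple V) : 'M[F]_(m, n) := \matrix_(i, j) (tnth s j) i 0.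

Lemma cols_mx_mul n (s : n.-tuple V) (x : 'cV_n) :
  cols_mx s *m x = \sum_j x j 0 *: s`_j.
Proof.
apply/colP => i; rewrite mxE summxE; apply: eq_bigr => j _.
by rewrite !mxE (tnth_nth 0) mulrC.
Qed.

Lemma cols_mx_free n (s : n.-tuple V) : full_col_rank (cols_mx s) <-> free s.
Proof.
split=> [s0|/freeP sf x].
  apply/freeP => c cs j; have := s0 (\col_j c j).
  rewrite cols_mx_mul => /(_ _)/colP/(_ j); rewrite !mxE; apply.
  by rewrite -[RHS]cs; apply: eq_bigr => i _; rewrite mxE.
by rewrite cols_mx_mul => /sf x0; apply/colP => j; rewrite x0 mxE.
Qed.

Lemma limg_cols_mx n (s : n.-tuple V) :
  limg (linfun (mulmx (cols_mx s) : 'cV_n -> V)) = << s >>%VS.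
Proof.
apply: subv_anti; apply/andP; split.
  apply/subvP => _ /memv_imgP[x _ ->]; rewrite lfunE /= cols_mx_mul.
  by apply: rpred_sum => j _; apply: rpredZ; apply: memv_span; rewrite mem_nth// size_tuple.
apply/span_subvP => v /tnthP[j ->]; apply/memv_imgP; exists (delta_mx j 0).
  exact: memvf.
by rewrite lfunE /= -colE; apply/colP => i; rewrite !mxE.
Qed.

Lemma exists_frame (U : Gr) :
  exists X : 'M[F]_(m, r), limg (linfun (mulmx X : 'cV_r -> V)) = val U.
Proof.
have sz : size (vbasis (val U)) == r by rewrite size_tuple (eqP (valP U)).
exists (cols_mx (Tuple sz)); rewrite limg_cols_mx /=.
exact: span_basis (vbasisP _).
Qed.

Definition gr_proj (U : Gr) : 'M[F]_m := range_proj (basis_mx U).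

Lemma basis_mx_full (U : Gr) : full_col_rank (basis_mx U).
Proof.
have -> : basis_mx U = cols_mx (vbasis (val U)).
  by apply/matrixP => i j; rewrite !mxE (tnth_nth 0).
by apply/cols_mx_free; exact: basis_free (vbasisP _).
Qed.

(** Two frames of the same subspace differ by an invertible matrix on the right, which cancels in
    the projection formula. *)
Lemma gr_proj_frame (U : Gr) (X : 'M[F]_(m, r)) :
  limg (linfun (mulmx X : 'cV_r -> V)) = val U ->
  full_col_rank X /\ gr_proj U = range_proj X.
Proof.
move=> /basis_mxE[]; rewrite /gr_proj; have := @basis_mx_full U.
move: (basis_mx U); rewrite (eqP (valP U)) => B fB P [Q [BXP QP]].
have [_ uP] := mulmx1_unit QP.
have fX : full_col_rank X.
  move=> x Xx; have : B *m (invmx P *m x) = 0 by rewrite BXP -mulmxA mulKVmx.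
  by move=> /fB Px; rewrite -[x](mulKVmx uP) Px mulmx0.
by split=> //; rewrite BXP range_proj_mul.
Qed.

Lemma span_frameE (w : coord_space R k m r) : full_col_rank (cols_mx (frame_of w)) ->
  limg (linfun (mulmx (cols_mx (frame_of w)) : 'cV_r -> V)) = val (span_frame rm w).
Proof.
move=> /cols_mx_free fw; rewrite limg_cols_mx val_insubd.
by move: fw; rewrite /free size_tuple => ->.
Qed.

Lemma span_frame_default (w : coord_space R k m r) :
  ~ full_col_rank (cols_mx (frame_of w)) -> span_frame rm w = point.
Proof.
move=> nw; apply: val_inj; rewrite val_insubd ifF//; apply/negP => dw; apply: nw.
by apply/cols_mx_free; rewrite /free size_tuple.
Qed.

Lemma mground_frame i j :
  mground (fun w : coord_space R k m r => cols_mx (frame_of w) i j).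
Proof.
rewrite (_ : (fun w => _) = (fun w : coord_space R k m r =>
    of_coords (tnth (tnth w j) i) : F)); last first.
  by apply/funext => w; rewrite !mxE tnth_mktuple mxE.
have mw : measurable_fun setT (fun w : coord_space R k m r => tnth (tnth w j) i).
  exact: (measurableT_comp (measurable_tnth i) (measurable_tnth j)).
exact: (mground_comp mw (@mground_of_coords R k)).
Qed.

End grassmannian_projection.

Lemma polyfun_det (F : comNzRingType) (I : Type) n d (M : (I -> F) -> 'M[F]_n) :
  (forall i j, polyfun d (fun x => M x i j)) ->
  exists e, polyfun e (fun x => \det (M x)).
Proof.
move=> pM; exists (0 + size (index_enum 'I_n) * d)%N; rewrite /determinant.
apply: polyfun_sum => s _; apply: polyfun_mul; first exact: polyfun_cst.
exact: polyfun_prod.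
Qed.

Section grassmannian_null.
Context (R : realType) (k : base_field) (m r : nat) (rm : (r < m)%N).
Local Notation F := (ground R k).
Local Notation V := 'cV[F]_m.
Local Notation Gr := (grassmannian R k rm).
Local Notation coords := (coord_space R k m r).
Local Notation mfun := (fun g : coords -> R => measurable_fun setT g).

(** On independent vectors the projection is a rational function of their coordinates, as the
    adjugate formula for the inverse Gram matrix shows; on dependent vectors it is constant. *)
Lemma mground_gr_proj_span i j :
  mground (fun w : coords => gr_proj (span_frame rm w) i j).
Proof.
pose W (w : coords) := cols_mx (frame_of w).
pose G w := adjmx (W w) *m W w.
have c1 := @measurable_fun_cstR R _ coords.
have c2 := @measurable_fun_addR R _ coords.
have c3 := @measurable_fun_mulR R _ coords.
have mW : groundfun_mx mfun W by move=> a b; exact: mground_frame.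
have mWa : groundfun_mx mfun (fun w => adjmx (W w)) by exact: groundfun_adjmx.
have mG : groundfun_mx mfun G by exact: groundfun_mulmx.
have mD : groundfun mfun (fun w => \det (G w)) by exact: groundfun_det.
have mDV : groundfun mfun (fun w => (\det (G w))^-1).
  by apply: groundfun_inv => // g g0 mg; exact: measurable_fun_invR.
have mJ : groundfun_mx mfun (fun w => (\det (G w))^-1 *: \adj (G w)).
  move=> a b; apply: (@groundfun_eq _ _ _ _
    (fun w => (\det (G w))^-1 * ((-1) ^+ (b + a) * \det (row' b (col' a (G w)))))).
    by move=> w; rewrite !mxE.
  apply: groundfun_mul => //; apply: groundfun_mul => //.
  apply: groundfun_det => // a' b'.
  by apply: (groundfun_eq _ (mG (lift b a') (lift a b'))) => w; rewrite !mxE.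
(* The factor 1 - det G / det G is 0 on independent vectors. On dependent ones it is 1, because the
   inverse of 0 is 0, and it selects the default value of [span_frame]. *)
apply: (@groundfun_eq _ _ _ _ (fun w =>
  (W w *m ((\det (G w))^-1 *: \adj (G w)) *m adjmx (W w)) i j +
  (1 + -1 * (\det (G w) * (\det (G w))^-1)) * gr_proj (point : Gr) i j)).
  move=> w; have [D0|D0] := eqVneq (\det (G w)) 0.
    rewrite D0 invr0 scale0r mulmx0 mul0mx mxE add0r !mulr0 addr0 mul1r.
    rewrite span_frame_default// => /gram_unit.
    by rewrite unitmxE -/(G w) D0 unitr0.
  have uG : G w \in unitmx by rewrite unitmxE unitfE.
  rewrite divff// mulr1 subrr mul0r addr0.
  have [_ ->] := gr_proj_frame (span_frameE rm ((gram_unit _).1 uG)).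
  by rewrite /range_proj -/(W w) -/(G w) /invmx uG.
apply: groundfun_add => //; last first.
  apply: groundfun_mul => //; apply: groundfun_add => //.
  by apply: groundfun_mul => //; apply: groundfun_mul.
by apply: groundfun_mulmx => //; exact: groundfun_mulmx.
Qed.

(** For the quotient sigma-algebra, a function of the subspace is measurable as soon as its
    composition with [span_frame] is. *)
Lemma mground_gr_proj i j : mground (fun U : Gr => gr_proj U i j).
Proof.
have [h1 h2] := mground_gr_proj_span i j.
by split=> _ B mB; rewrite setTI; [have := h1 measurableT B mB|have := h2 measurableT B mB];
  rewrite setTI.
Qed.

(** Each matrix [g] of natural numbers yields r vectors of U that depend on U alone, so these
    countably many tuples need no measurable choice of a frame. *)
Definition gr_points (g : 'M[nat]_(m, r)) (U : Gr) (i : 'I_m * 'I_r) : F :=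
  (gr_proj U *m map_mx (fun n => n%:R) g) i.1 i.2.

Lemma mground_gr_points g i : mground (fun U => gr_points g U i).
Proof.
have c1 := @measurable_fun_cstR R _ Gr.
have c2 := @measurable_fun_addR R _ Gr.
have c3 := @measurable_fun_mulR R _ Gr.
apply: (groundfun_mulmx c1 c2 c3 (M := fun U => gr_proj U)
  (N := fun=> map_mx (fun n => n%:R) g)) => a b; last by apply: groundfun_cst.
exact: mground_gr_proj.
Qed.

(** Pulled back to normal frames W: if P vanishes at the projections of all natural matrices, it
    vanishes at the projections of all matrices, hence at W itself. So W is a zero of P or
    degenerate, and both sets are null. *)
Lemma poly_null_grassmannian :
  poly_null (grassmannian_uniform R k rm) gr_points.
Proof.
split=> [|e P pP [z Pz]]; first exact: mground_gr_points.
have [_ nF] := poly_null_frame R k m r.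
pose vars (x : 'I_r * ('I_m * unit) -> F) (i : 'I_m * 'I_r) := x (i.2, (i.1, tt)).
have pvars i : polyfun 1 (fun x => vars x i) := @polyfun_var _ _ 0 _.
pose Q x := P (vars x).
have pQ : polyfun (e * 1) Q by exact: polyfun_comp pP pvars.
have NQ := nF _ _ pQ; rewrite /Q in NQ.
(* The minor of the first r rows; where it is nonzero, the r vectors are independent. *)
pose minor (x : 'I_r * ('I_m * unit) -> F) := \det (\matrix_(i < r, j < r)
  x (j, (widen_ord (ltnW rm) i, tt))).
have [e' pminor] : exists e, polyfun e minor.
  apply: (@polyfun_det _ _ _ 1) => i j.
  rewrite (_ : (fun x => _) = (fun x : _ -> F => x (j, (widen_ord (ltnW rm) i, tt)))).
    exact: (@polyfun_var _ _ 0).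
  by apply/funext => x; rewrite mxE.
have Nm := nF _ _ pminor.
set N1 := [set w | _] in NQ; set N2 := [set w | _] in Nm.
have mh : forall g i, mground (fun w : coords =>
   (of_coords (tnth (tnth w i.1) i.2.1) : F)) := (poly_null_frame R k m r).1.
have mN1 : measurable N1 by exact: measurable_poly_zeros mh pQ.
have mN2 : measurable N2 by exact: measurable_poly_zeros mh pminor.
have N1_0 : normal_frame_prob R k m r N1 = 0%E.
  by apply: NQ; exists (fun i => z (i.2.1, i.1)); move: Pz; congr (P _ != 0); apply/funext => -[].
have N2_0 : normal_frame_prob R k m r N2 = 0%E.
  apply: Nm; exists (fun i => (i.2.1 == widen_ord (ltnW rm) i.1)%:R).
  rewrite /minor (_ : \matrix_(_, _) _ = 1%:M) ?det1 ?oner_eq0//.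
  by apply/matrixP => i j; rewrite !mxE /= -val_eqE.
rewrite /grassmannian_uniform /= /distribution /pushforward.
apply/eqP; rewrite eq_le measure_ge0 andbT.
apply: (@le_trans _ _ (normal_frame_prob R k m r (N1 `|` N2))); last first.
  rewrite -N1_0 le_eqVlt; apply/orP; left; apply/eqP; exact: measureU0.
apply: le_measure; rewrite ?inE//.
- have : measurable [set U : Gr | forall g, P (gr_points g U) = 0].
    exact: measurable_poly_zeros mground_gr_points pP.
  done.
- exact: measurableU.
move=> w /= Pw; set W := cols_mx (frame_of w).
have WE i j : W i j = of_coords (tnth (tnth w j) i).
  by rewrite !mxE tnth_mktuple mxE.
have [fW|nW] := pselect (full_col_rank W); last first.
  right => g /=; rewrite /minor; apply/eqP; apply: contra_notT nW => dW x Wx.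
  set A := \matrix_(_, _) _ in dW.
  have /unitmx_full_col_rank : A \in unitmx by rewrite unitmxE unitfE.
  apply; apply/colP => i; rewrite [RHS]mxE.
  transitivity ((W *m x) (widen_ord (ltnW rm) i) 0); last by rewrite Wx mxE.
  by rewrite [LHS]mxE [RHS]mxE; apply: eq_bigr => j _; rewrite WE /A [in LHS]mxE.
left=> _ /=.
have [_ projW] := gr_proj_frame (span_frameE rm fW).
have PG : forall x : 'I_m * 'I_r -> F,
    P (fun i => (range_proj W *m (\matrix_(a, b) x (a, b))) i.1 i.2) = 0.
  pose phi (x : 'I_m * 'I_r -> F) (i : 'I_m * 'I_r) : F :=
    (range_proj W *m (\matrix_(a, b) x (a, b))) i.1 i.2.
  have pphi i : polyfun 1 (fun x => phi x i).
    rewrite (_ : (fun x => _) = fun x : _ -> F => \sum_l range_proj W i.1 l * x (l, i.2)).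
      apply: polyfun_sum => l _; apply: (@polyfun_mul _ _ 0 1).
        exact: polyfun_cst.
      exact: (@polyfun_var _ _ 0).
    by apply/funext => x; rewrite /phi mxE; apply: eq_bigr => l _; congr (_ * _); rewrite mxE.
  apply: (polyfun_grid_eq0 (polyfun_comp pP pphi)) => g.
  rewrite -(Pw (\matrix_(a, b) (g (a, b) : nat))); congr P; apply/funext => i.
  rewrite /phi /gr_points projW; congr ((_ *m _) _ _).
  by apply/matrixP => a b; rewrite !mxE.
(* The projection onto the range of W fixes W. *)
rewrite -(PG (fun i => W i.1 i.2)) /vars; congr P; apply/funext => -[i j] /=.
rewrite (_ : \matrix_(_, _) _ = W) ?range_proj_id//; last by apply/matrixP => a b; rewrite mxE.
Qed.

End grassmannian_null.

(** * Positive definite matrices *)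

Lemma scalar_mx11 (F : pzRingType) (A : 'M[F]_1) : A = (A 0 0)%:M.
Proof. by apply/matrixP => i j; rewrite !ord1 mxE eqxx. Qed.

Section congruence.
Context (R : realType) (k : base_field).
Local Notation F := (ground R k).
Local Notation re := (@ground_re R k).
Local Notation iota := (ground_of_real R k).

Definition rdiag m (d : 'I_m -> R) : 'M[F]_m := diag_mx (\row_i iota (d i)).

Lemma posdefmx_det_neq0 m (S : 'M[F]_m) : posdefmx S -> \det S != 0.
Proof.
move=> pS; rewrite -unitfE -unitmxE; apply/unitmx_full_col_rank => x Sx.
by apply: contrapT => /eqP/pS; rewrite -mulmxA Sx mulmx0 mxE ltxx.
Qed.

Lemma posdefmx_congr m p (S : 'M[F]_m) (K : 'M[F]_(m, p)) :
  posdefmx S -> full_col_rank K -> posdefmx (adjmx K *m S *m K).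
Proof.
move=> pS fK x x0; have Kx : K *m x != 0.
  by apply: contraNneq x0 => /fK ->.
by have := pS _ Kx; rewrite adjmxM !mulmxA.
Qed.

Lemma hermitian_congr m p (S : 'M[F]_m) (K : 'M[F]_(m, p)) :
  adjmx S = S -> adjmx (adjmx K *m S *m K) = adjmx K *m S *m K.
Proof. by move=> hS; rewrite !adjmxM adjmxK hS mulmxA. Qed.

Lemma adjmx_rdiag m (d : 'I_m -> R) : adjmx (rdiag d) = rdiag d.
Proof.
apply/matrixP => i j; rewrite !mxE; case: (eqVneq i j) => [->|ij].
  by rewrite ?eqxx !mulr1n ground_conj_real.
by rewrite !mulr0n rmorph0.
Qed.

Lemma rdiagM m (d e : 'I_m -> R) : rdiag d *m rdiag e = rdiag (fun i => d i * e i).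
Proof.
rewrite /rdiag mulmx_diag; congr diag_mx.
by apply/rowP => i; rewrite !mxE rmorphM.
Qed.

Lemma rdiag1 m : rdiag (fun=> 1) = 1%:M :> 'M[F]_m.
Proof.
by apply/matrixP => i j; rewrite !mxE rmorph1.
Qed.

Lemma det_rdiag m (d : 'I_m -> R) : \det (rdiag d) = iota (\prod_i d i).
Proof. by rewrite det_diag rmorph_prod; apply: eq_bigr => i _; rewrite mxE. Qed.

Lemma det_congr_rdiag m (h : 'M[F]_m) (d : 'I_m -> R) :
  \det (adjmx h *m rdiag d *m h) = iota (ground_normsq (\det h) * \prod_i d i).
Proof.
by rewrite !det_mulmx det_adjmx det_rdiag mulrAC ground_conj_mul -rmorphM.
Qed.

End congruence.

(** * Simultaneous diagonalization of Hermitian forms *)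

Section eigenpair.
Context (R : realType).

Lemma eigenpair_closed (C : numClosedFieldType) m (S0 S1 : 'M[C]_m) : (0 < m)%N ->
  S0 \in unitmx -> exists a (x : 'cV_m), x != 0 /\ S1 *m x = a *: (S0 *m x).
Proof.
move=> m0 uS; have [a /eigenvalueP[v vA v0]] := eigenvalue_closed (invmx S0 *m S1)^T m0.
exists a, v^T; split; first by rewrite trmx_eq0.
have : invmx S0 *m S1 *m v^T = a *: v^T.
  by apply: trmx_inj; rewrite trmx_mul trmxK vA linearZ /= trmxK.
by move=> /(congr1 (mulmx S0)); rewrite -mulmxA mulKVmx// -scalemxAr.
Qed.

(** A complex eigenvector u + i v of the pair exists. Its eigenvalue is real by symmetry and
    positivity, so u or v is a real eigenvector. *)
Lemma eigenpair_real m (S0 S1 : 'M[R]_m) : (0 < m)%N ->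
  S0^T = S0 -> S1^T = S1 -> (forall x : 'cV_m, x != 0 -> 0 < (x^T *m S0 *m x) 0 0) ->
  exists a (x : 'cV_m), x != 0 /\ S1 *m x = a *: (S0 *m x).
Proof.
move=> m0 h0 h1 p0.
have u0 : S0 \in unitmx.
  rewrite -unitmx_tr -row_free_unit -kermx_eq0; apply/rowV0P => v /sub_kermxP vA.
  apply: contrapT => /eqP v0.
  have := p0 v^T; rewrite trmx_eq0 => /(_ v0).
  by rewrite trmxK -[S0]h0 vA mul0mx mxE ltxx.
pose toC p q (A : 'M[R]_(p, q)) : 'M[R[i]]_(p, q) := map_mx (real_complex R) A.
have uC : toC _ _ S0 \in unitmx by rewrite map_unitmx.
have [a [z [z0 Sz]]] := eigenpair_closed (toC _ _ S1) m0 uC.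
pose u := map_mx (@complex.Re R) z; pose v := map_mx (@complex.Im R) z.
have ReM (S : 'M[R]_m) i : complex.Re ((toC _ _ S *m z) i 0) = (S *m u) i 0.
  rewrite !mxE raddf_sum; apply: eq_bigr => j _; rewrite !mxE.
  by case: (z j 0) => ? ? /=; rewrite mul0r subr0.
have ImM (S : 'M[R]_m) i : complex.Im ((toC _ _ S *m z) i 0) = (S *m v) i 0.
  rewrite !mxE raddf_sum; apply: eq_bigr => j _; rewrite !mxE.
  by case: (z j 0) => ? ? /=; rewrite mul0r addr0.
have Sz0 i : (toC _ _ S1 *m z) i 0 = a * (toC _ _ S0 *m z) i 0 by rewrite Sz mxE.
have comb (al be : R) (p q : 'cV[R]_m) i : (al *: p + be *: q) i 0 = al * p i 0 + be * q i 0.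
  by rewrite [LHS]mxE [X in X + _]mxE [X in _ + X]mxE.
have Su : S1 *m u = complex.Re a *: (S0 *m u) + (- complex.Im a) *: (S0 *m v).
  apply/colP => i; rewrite comb -!ReM -ImM Sz0.
  by case: (a) (_ i 0) => [a1 a2] [b1 b2] /=; rewrite mulNr.
have Sv : S1 *m v = complex.Re a *: (S0 *m v) + complex.Im a *: (S0 *m u).
  apply/colP => i; rewrite comb -!ImM -ReM Sz0.
  by case: (a) (_ i 0) => [a1 a2] [b1 b2].
have bil (x p q : 'cV_m) (al be : R) :
    S1 *m x = al *: (S0 *m p) + be *: (S0 *m q) ->
    forall y : 'cV_m, (y^T *m S1 *m x) 0 0 =
    al * (y^T *m S0 *m p) 0 0 + be * (y^T *m S0 *m q) 0 0.
  move=> Sx y; rewrite -mulmxA Sx mulmxDr -!scalemxAr !mulmxA.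
  by rewrite [LHS]mxE [X in X + _]mxE [X in _ + X]mxE.
have sym (S : 'M[R]_m) (x y : 'cV_m) : S^T = S -> (x^T *m S *m y) 0 0 = (y^T *m S *m x) 0 0.
  move=> hS; transitivity ((x^T *m S *m y)^T 0 0); first by rewrite [RHS]mxE.
  by rewrite !trmx_mul trmxK hS mulmxA.
have q0 (x : 'cV_m) : 0 <= (x^T *m S0 *m x) 0 0.
  by have [->|/p0/ltW//] := eqVneq x 0; first rewrite mulmx0 mxE.
have uv0 : (u != 0) || (v != 0).
  rewrite -negb_and; apply: contraNN z0 => /andP[/eqP/colP u0' /eqP/colP v0'].
  apply/eqP/colP => i; move: (u0' i) (v0' i); rewrite !mxE.
  by case: (z i 0) => ? ? /= -> ->.
(* Comparing u^T S1 v with v^T S1 u gives Im a (u^T S0 u + v^T S0 v) = 0, and the bracket is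
   positive. *)
have a0 : complex.Im a = 0.
  have := sym S1 u v h1; rewrite (bil _ _ _ _ _ Sv) (bil _ _ _ _ _ Su).
  rewrite (sym S0 u v h0) => E; apply/eqP; apply: contraTT uv0 => a0.
  have Q : (u^T *m S0 *m u) 0 0 + (v^T *m S0 *m v) 0 0 = 0.
    by apply: (mulfI a0); rewrite mulr0 mulrDr; lra.
  rewrite negb_or !negbK; apply/andP; split; apply: contrapT => /negP/p0 lt;
    [have := q0 v|have := q0 u]; lra.
rewrite a0 oppr0 scale0r addr0 in Su; rewrite a0 scale0r addr0 in Sv.
by case/orP: uv0 => ?; [exists (complex.Re a), u|exists (complex.Re a), v].
Qed.

End eigenpair.

Section simultaneous_diagonalization.
Context (R : realType) (k : base_field).
Local Notation F := (ground R k).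
Local Notation re := (@ground_re R k).
Local Notation iota := (ground_of_real R k).

Lemma hermitian_form_real m (S : 'M[F]_m) (x : 'cV_m) : adjmx S = S ->
  (adjmx x *m S *m x) 0 0 = iota (re ((adjmx x *m S *m x) 0 0)).
Proof.
move=> hS; apply: ground_realP.
by rewrite -[in RHS](hermitian_congr x hS) !mxE.
Qed.

(** The eigenvalue is real as the quotient of the real numbers x^* S1 x and x^* S0 x. *)
Lemma eigenpair_ground m (S0 S1 : 'M[F]_m) : (0 < m)%N ->
  adjmx S0 = S0 -> adjmx S1 = S1 -> posdefmx S0 ->
  exists (a : R) (x : 'cV_m), x != 0 /\ S1 *m x = iota a *: (S0 *m x).
Proof.
move=> m0 h0 h1 p0.
have : exists (a : F) (x : 'cV_m), x != 0 /\ S1 *m x = a *: (S0 *m x).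
  have u0 : S0 \in unitmx by rewrite unitmxE unitfE posdefmx_det_neq0.
  move: S0 S1 h0 h1 p0 u0; rewrite /adjmx /posdefmx /ground_conj /ground.
  case: k => /= S0 S1 h0 h1 p0 u0; last exact: eigenpair_closed.
  apply: eigenpair_real => //.
  - by rewrite -[RHS]h0; apply/matrixP => i j; rewrite !mxE.
  - by rewrite -[RHS]h1; apply/matrixP => i j; rewrite !mxE.
  move=> x /p0; congr (0 < (_ *m _ *m _) 0 0).
  by apply/matrixP => i j; rewrite !mxE.
move=> [a [x [x0 Sx]]]; exists (re a), x; split=> //; rewrite Sx; congr (_ *: _).
have E : (adjmx x *m S1 *m x) 0 0 = a * (adjmx x *m S0 *m x) 0 0.
  by rewrite -mulmxA Sx -scalemxAr mulmxA mxE.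
apply: ground_realP; move: E; rewrite hermitian_form_real// (hermitian_form_real x h0) => E.
have q0 : iota (re ((adjmx x *m S0 *m x) 0 0)) != 0.
  by rewrite -hermitian_form_real// gt_eqF// p0.
apply: (mulIf q0); rewrite -E -[in LHS]ground_conj_real -rmorphM -E.
by rewrite ground_conj_real.
Qed.

(** The columns of [K] form a basis of the hyperplane on which the nonzero linear form [w]
    vanishes. *)
Lemma orthogonal_columns m (w : 'rV[F]_m.+1) : w != 0 ->
  exists K : 'M[F]_(m.+1, m), full_col_rank K /\ w *m K = 0.
Proof.
move=> w0; have rk : \rank (kermx w^T) = m.
  by rewrite mxrank_ker mxrank_tr rank_rV w0 subn1.
have [N [fN Nw]] : exists N : 'M[F]_(m, m.+1), row_free N /\ N *m w^T = 0.
  have := row_base_free (kermx w^T).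
  have : (row_base (kermx w^T) <= kermx w^T)%MS by rewrite eq_row_base.
  move: (row_base _); rewrite rk => N /sub_kermxP Nw fN.
  by exists N.
exists N^T; split; last by rewrite -[w]trmxK -trmx_mul Nw trmx0.
move=> y Ny; apply: trmx_inj; rewrite trmx0; apply/eqP.
by rewrite -(mulmx_free_eq0 _ fN) -[N]trmxK -trmx_mul Ny trmx0.
Qed.

Definition cons_fun (T : Type) m (c : T) (d : 'I_m -> T) (i : 'I_m.+1) : T :=
  if unlift ord0 i is Some j then d j else c.

Lemma rdiag_cons m (c : R) (d : 'I_m -> R) :
  @rdiag R k m.+1 (cons_fun c d) = block_mx (iota c)%:M 0 0 (rdiag k d) :> 'M[F]_(1 + m).
Proof.
rewrite /rdiag -[X in block_mx X](_ : diag_mx (\row_(i < 1) iota c) = _); last first.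
  by apply/matrixP => i j; rewrite !mxE !ord1.
rewrite -diag_mx_row; congr diag_mx; apply/rowP => i; rewrite !mxE.
rewrite /cons_fun; case: (unliftP ord0 i) => [j|] ->.
  rewrite (_ : lift ord0 j = rshift 1 j); last exact/val_inj.
  by case: split_ordP => j' /eqP; rewrite ?eq_rlshift// eq_rshift => /eqP <-; rewrite mxE.
rewrite (_ : (ord0 : 'I_m.+1) = lshift m (ord0 : 'I_1)); last exact/val_inj.
by case: split_ordP => j' /eqP; rewrite ?eq_lrshift// => _; rewrite mxE.
Qed.

(** In the basis (x, K) the form is block diagonal. The congruence matrix is built from x, K and h
    without [S], so the same one serves both forms. *)
Lemma simultaneous_diag_step m (x : 'cV[F]_m.+1) (K : 'M[F]_(m.+1, m)) (h : 'M[F]_m)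
    (S : 'M[F]_m.+1) (d : 'I_m -> R) (B := row_mx x K : 'M[F]_(m.+1)) :
  B \in unitmx -> adjmx S = S -> adjmx x *m S *m K = 0 ->
  adjmx K *m S *m K = adjmx h *m rdiag k d *m h ->
  S = adjmx ((block_mx 1%:M 0 0 h : 'M[F]_(1 + m)) *m invmx B) *m
      rdiag k (cons_fun (re ((adjmx x *m S *m x) 0 0)) d) *m
      ((block_mx 1%:M 0 0 h : 'M[F]_(1 + m)) *m invmx B).
Proof.
move=> uB hS xSK KSK.
have KSx : adjmx K *m S *m x = 0.
  transitivity (adjmx (adjmx x *m S *m K)); first by rewrite !adjmxM adjmxK hS mulmxA.
  by rewrite xSK; apply/matrixP => i j; rewrite !mxE rmorph0.
have adjB : adjmx B = col_mx (adjmx x) (adjmx K).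
  by rewrite /adjmx -map_col_mx -tr_row_mx.
have E : adjmx B *m S *m B = adjmx (block_mx 1%:M 0 0 h : 'M[F]_(1 + m)) *m
    rdiag k (cons_fun (re ((adjmx x *m S *m x) 0 0)) d) *m
    (block_mx 1%:M 0 0 h : 'M[F]_(1 + m)).
  transitivity (col_mx (adjmx x *m S) (adjmx K *m S) *m row_mx x K : 'M[F]_(1 + m)).
    rewrite adjB; congr (_ *m _).
    exact: (@mul_col_mx _ 1 m m.+1 m.+1 (adjmx x) (adjmx K) S).
  rewrite mul_col_row xSK KSx KSK.
  transitivity (block_mx 1%:M 0 0 (adjmx h) *m
    block_mx (iota (re ((adjmx x *m S *m x) 0 0)))%:M 0 0 (rdiag k d) *m
    block_mx 1%:M 0 0 h : 'M[F]_(1 + m)).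
    rewrite !mulmx_block !(mulmx0, mul0mx, addr0, add0r, mulmx1, mul1mx).
    by rewrite -hermitian_form_real// -scalar_mx11.
  congr (_ *m _ *m _); last exact/esym/rdiag_cons.
  by rewrite /adjmx tr_block_mx map_block_mx !trmx0 !map_mx0 trmx1 map_mx1.
transitivity (adjmx (invmx B) *m (adjmx B *m S *m B) *m invmx B).
  rewrite !mulmxA -adjmxM mulmxV// adjmx1 mul1mx.
  by rewrite -mulmxA mulmxV// mulmx1.
by rewrite E adjmxM !mulmxA.
Qed.

(** Induction on m: split off an eigenvector x of the pair and restrict both forms to the
    S0-orthogonal complement of x. *)
Lemma simultaneous_diag m (S0 S1 : 'M[F]_m) :
  adjmx S0 = S0 -> adjmx S1 = S1 -> posdefmx S0 ->
  exists (h : 'M[F]_m) (d0 d1 : 'I_m -> R), [/\ h \in unitmx,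
    S0 = adjmx h *m rdiag k d0 *m h & S1 = adjmx h *m rdiag k d1 *m h].
Proof.
elim: m S0 S1 => [|m IH] S0 S1 h0 h1 p0.
  exists 1%:M, (fun=> 0), (fun=> 0); split; first exact: unitmx1.
    by apply/matrixP => -[].
  by apply/matrixP => -[].
have [a [x [x0 Sx]]] := eigenpair_ground (ltn0Sn m) h0 h1 p0.
pose w := adjmx x *m S0.
have wx : (w *m x) 0 0 != 0 by rewrite gt_eqF// p0.
have w0 : w != 0 by apply: contraNneq wx => ->; rewrite mul0mx mxE.
have [K [fK wK]] := orthogonal_columns w0.
have [h [d0 [d1 [uh E0 E1]]]] := IH (adjmx K *m S0 *m K) (adjmx K *m S1 *m K)
  (hermitian_congr K h0) (hermitian_congr K h1) (posdefmx_congr p0 fK).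
have uB : (row_mx x K : 'M[F]_m.+1) \in unitmx.
  apply/unitmx_full_col_rank => y.
  pose yu := usubmx (y : 'cV[F]_(1 + m)); pose yd := dsubmx (y : 'cV[F]_(1 + m)).
  have yE : y = col_mx yu yd by rewrite vsubmxK.
  move=> By; have xy : x *m yu + K *m yd = 0 by rewrite -mul_row_col vsubmxK.
  have y1 : yu = 0.
    have := congr1 (mulmx w) xy; rewrite mulmxDr mulmx0 !mulmxA wK mul0mx addr0.
    rewrite [w *m x]scalar_mx11 mul_scalar_mx => /eqP.
    by rewrite scaler_eq0 (negPf wx) => /eqP.
  move: xy; rewrite yE y1 mulmx0 add0r => /fK ->.
  exact: (@col_mx0 _ 1 m 1).
(* Since S1 x is a real multiple of S0 x, the complement is orthogonal to x for S1 as well. *)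
have x1 : adjmx x *m S1 *m K = 0.
  have -> : adjmx x *m S1 = iota a *: w.
    transitivity (adjmx (S1 *m x)); first by rewrite adjmxM h1.
    rewrite Sx; transitivity (iota a *: adjmx (S0 *m x)); last by rewrite adjmxM h0.
    by apply/matrixP => i j; rewrite !mxE rmorphM ground_conj_real.
  by rewrite -scalemxAl wK scaler0.
exists ((block_mx 1%:M 0 0 h : 'M[F]_(1 + m)) *m invmx (row_mx x K : 'M[F]_m.+1)).
exists (cons_fun (re ((adjmx x *m S0 *m x) 0 0)) d0).
exists (cons_fun (re ((adjmx x *m S1 *m x) 0 0)) d1).
split; [|exact: simultaneous_diag_step|exact: simultaneous_diag_step].
have db : \det (block_mx 1%:M 0 0 h : 'M[F]_(1 + m)) = \det h.
  by rewrite det_ublock det1 mul1r.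
by rewrite unitmx_mul unitmx_inv uB andbT unitmxE [X in X \is a _]db -unitmxE.
Qed.

End simultaneous_diagonalization.

Lemma continuous_box_min (R : realType) N (lo hi : 'I_N -> R) (h f : 'rV[R]_N -> R)
    (A := [set v : 'rV[R]_N | (forall i, lo i <= v 0 i <= hi i) /\ h v = 0]) :
  continuous h -> continuous f -> A !=set0 ->
  exists2 v, A v & forall w, A w -> f v <= f w.
Proof.
move=> ch cf A0; have cA : compact A.
  have -> : A = [set v : 'rV[R]_N | forall i, `[lo i, hi i]%classic (v ord0 i)]
      `&` h @^-1` [set 0].
    by apply/seteqP; split => v /= -[bv hv]; split=> // i; have := bv i; rewrite in_itv.
  apply: compact_closedI.
    by apply: (@rV_compact R N (fun i => `[lo i, hi i]%classic)) => i; exact: segment_compact.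
  by apply: closed_comp => [x _|]; [exact: ch|exact: closed_eq].
have cfA : {within A, continuous f} by exact: continuous_subspaceT.
have [v vA vmin] := EVT_min_rV A0 cA cfA.
by exists v; [rewrite inE in vA|move=> w Aw; apply: vmin; rewrite inE].
Qed.

(** * Gram determinants as weighted sums of minors *)

Section gram_product.
Context (R : realType) (k : base_field).
Local Notation F := (ground R k).
Local Notation re := (@ground_re R k).
Local Notation im := (@ground_im R k).
Local Notation iota := (ground_of_real R k).
Local Notation nsq := (@ground_normsq R k).
Context (m r : nat).

(** The Cauchy-Binet sum for det(Y^* diag(d) Y), multiplied by r! because it runs over all maps f
    instead of r-sets. *)
Definition weighted_minors (Y : 'M[F]_(m, r)) (d : 'I_m -> R) : R :=
  \sum_(f : {ffun 'I_r -> 'I_m}) (\prod_i d (f i)) * nsq (\det (rowsub f Y)).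

Lemma det_gram_rdiag (Y : 'M[F]_(m, r)) (d : 'I_m -> R) :
  \det (adjmx Y *m rdiag k d *m Y) = iota (r`!%:R^-1 * weighted_minors Y d).
Proof.
have r0 : (r`!%:R : F) != 0 by rewrite pnatr_eq0 -lt0n fact_gt0.
apply: (mulfI r0); rewrite cauchy_binet rmorphM fmorphV rmorph_nat mulVKf//.
rewrite /weighted_minors rmorph_sum; apply: eq_bigr => f _.
rewrite rmorphM /= -ground_conj_mul mulrA; congr (_ * _).
have -> : colsub f (adjmx Y *m rdiag k d) =
    adjmx (rowsub f Y) *m rdiag k (fun i => d (f i)).
  by apply/matrixP => i j; rewrite mxE !mul_mx_diag !mxE.
by rewrite det_mulmx det_rdiag det_adjmx mulrC.
Qed.

Lemma full_col_rank_row_full (Y : 'M[F]_(m, r)) : full_col_rank Y -> row_full Y.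
Proof.
move=> fY; rewrite /row_full -mxrank_tr -/(row_free _) -kermx_eq0.
apply/rowV0P => v /sub_kermxP vY; apply: trmx_inj; rewrite trmx0; apply: fY.
by rewrite -[Y]trmxK -trmx_mul vY trmx0.
Qed.

Lemma weighted_minors_gt0 (Y : 'M[F]_(m, r)) (d : 'I_m -> R) :
  full_col_rank Y -> (forall i, 0 < d i) -> 0 < weighted_minors Y d.
Proof.
move=> /full_col_rank_row_full fY d0; pose f := [ffun i => fullrankfun fY i].
have uf : \det (rowsub f Y) != 0.
  rewrite -unitfE -unitmxE (_ : rowsub f Y = rowsub (fullrankfun fY) Y) ?fullrowsub_unit//.
  by apply/matrixP => i j; rewrite !mxE ffunE.
rewrite /weighted_minors (bigD1 f)//= ltr_pwDl//.
  by rewrite mulr_gt0 ?ground_normsq_gt0// prodr_gt0.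
by apply: sumr_ge0 => f' _; rewrite mulr_ge0 ?ground_normsq_ge0// prodr_ge0// => i _; exact: ltW.
Qed.

Context (n : nat) (X : 'I_n -> 'M[F]_(m, r)).

Definition gram_prod (S : 'M[F]_m) : R :=
  \prod_k re (\det (adjmx (X k) *m S *m X k)).

Definition congr_rdiag (g : 'M[F]_m) (d : 'I_m -> R) := adjmx g *m rdiag k d *m g.

Lemma det_gram_congr (Y : 'M[F]_(m, r)) g d :
  re (\det (adjmx Y *m congr_rdiag g d *m Y)) = r`!%:R^-1 * weighted_minors (g *m Y) d.
Proof.
rewrite -[RHS](ground_re_real k) -det_gram_rdiag adjmxM /congr_rdiag.
by rewrite !mulmxA.
Qed.

Lemma det_gram_congr_gt0 (Y : 'M[F]_(m, r)) g d : full_col_rank Y -> g \in unitmx ->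
  (forall i, 0 < d i) -> 0 < re (\det (adjmx Y *m congr_rdiag g d *m Y)).
Proof.
move=> fY ug d0; rewrite det_gram_congr mulr_gt0 ?invr_gt0 ?ltr0n ?fact_gt0//.
apply: weighted_minors_gt0 => // x; rewrite -mulmxA => gYx; apply: fY.
by rewrite -[_ *m x](mulKmx ug) gYx mulmx0.
Qed.

(* A compact set of invertible matrices that contains the unitary ones. *)
Definition unitary_box (g : 'M[F]_m) :=
  (forall i j, `|re (g i j)| <= 1 /\ `|im (g i j)| <= 1) /\ nsq (\det g) = 1.

Lemma unitary_box_unit g : unitary_box g -> g \in unitmx.
Proof.
by move=> [_ dg]; rewrite unitmxE unitfE -ground_normsq_eq0 dg oner_neq0.
Qed.

Lemma unitary_box1 : unitary_box 1%:M.
Proof.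
split; last first.
  by rewrite det1 /ground_normsq (ground_re_nat R k 1) ground_im1 expr1n expr0n addr0.
move=> i j; rewrite mxE -(rmorph_nat iota) ground_re_real ground_im_real normr0.
by split=> //; case: (i == j); rewrite ?normr0 ?normr1.
Qed.

(** [d i] is the value of the form at the vector that h sends to the i-th unit vector. *)
Lemma congr_rdiag_gt0 h d : h \in unitmx -> posdefmx (congr_rdiag h d) ->
  forall i, 0 < d i.
Proof.
move=> uh pS i; pose x : 'cV[F]_m := invmx h *m delta_mx i 0.
have hx : h *m x = delta_mx i 0 by rewrite mulKVmx.
have x0 : x != 0.
  apply/eqP => x0; have /colP/(_ i) := hx; rewrite x0 mulmx0 !mxE !eqxx.
  by move=> /eqP; rewrite eq_sym oner_eq0.
have := pS _ x0.
have -> : adjmx x *m congr_rdiag h d *m x =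
    adjmx (h *m x) *m rdiag k d *m (h *m x) by rewrite /congr_rdiag (adjmxM h x) !mulmxA.
have -> : adjmx (h *m x) = delta_mx 0 i.
  by rewrite hx; apply/matrixP => a b; rewrite !mxE rmorph_nat andbC.
by rewrite hx -rowE -colE !mxE eqxx mulr1n ground_real_gt0.
Qed.

(** The spectral theorem, obtained by diagonalizing [S] together with the identity. The columns of
    the resulting [g] have norm 1, which bounds its entries. *)
Lemma Pos_congr_rdiag S : Pos S -> exists (g : 'M[F]_m) (d : 'I_m -> R),
  [/\ unitary_box g, forall i, 0 < d i, \prod_i d i = 1 & S = congr_rdiag g d].
Proof.
move=> [hS pS dS]; have p1 : posdefmx (1%:M : 'M[F]_m).
  move=> x x0; rewrite mulmx1 adjmx_mulE ground_real_gt0.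
  rewrite lt_neqAle sumr_ge0 ?andbT => [|i _]; last exact: ground_normsq_ge0.
  rewrite eq_sym; apply: contraNneq x0 => x0; apply/eqP/adjmx_mul_eq0.
  by apply/matrixP => i j; rewrite !ord1 adjmx_mulE x0 rmorph0 mxE.
have [h [d0 [d1 [uh E1 ES]]]] := simultaneous_diag (adjmx1 R k m) hS p1.
have dpos S' d : posdefmx S' -> S' = congr_rdiag h d -> forall i, 0 < d i.
  by move=> pS' E; apply: (congr_rdiag_gt0 uh); rewrite -E.
have d0_gt0 := dpos _ _ p1 E1; have d1_gt0 := dpos _ _ pS ES.
(* From 1 = h^* diag(d0) h, the matrix g = diag(sqrt d0) h is unitary, and S = g^* diag(d1 / d0)
   g. *)
pose e i := Num.sqrt (d0 i); have e0 i : 0 < e i by rewrite sqrtr_gt0.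
pose g := rdiag k e *m h; exists g, (fun i => d1 i / d0 i).
have gE d : congr_rdiag g d = adjmx h *m rdiag k (fun i => d i * d0 i) *m h.
  rewrite /congr_rdiag /g adjmxM adjmx_rdiag -!mulmxA (mulmxA _ _ h) (mulmxA _ _ h).
  rewrite !rdiagM !mulmxA; congr (_ *m rdiag k _ *m _); apply/funext => i.
  by rewrite mulrCA -expr2 sqr_sqrtr// ltW.
have gg : adjmx g *m g = 1%:M.
  have := gE (fun=> 1); rewrite /congr_rdiag rdiag1 mulmx1 => ->.
  by rewrite [RHS]E1; congr (_ *m rdiag k _ *m _); apply/funext => i; rewrite mul1r.
have Sg : S = congr_rdiag g (fun i => d1 i / d0 i).
  rewrite gE [LHS]ES; congr (_ *m rdiag k _ *m _); apply/funext => i.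
  by rewrite divfK// gt_eqF.
have ng : nsq (\det g) = 1.
  apply: (@ground_real_inj R k); rewrite -ground_conj_mul -det_adjmx -det_mulmx gg.
  by rewrite det1 rmorph1.
split=> //.
- split=> // i j; have : \sum_l nsq (g l j) = 1.
    have /matrixP/(_ j j) := gg; rewrite !mxE eqxx => E.
    apply: (@ground_real_inj R k); rewrite rmorph1 -[RHS]E rmorph_sum.
    by apply: eq_bigr => l _; rewrite !mxE ground_conj_mul.
  rewrite (bigD1 i)//= => E.
  have : nsq (g i j) <= 1.
    by rewrite -E lerDl sumr_ge0// => l _; exact: ground_normsq_ge0.
  rewrite /ground_normsq => le1.
  have := sqr_ge0 (re (g i j)); have := sqr_ge0 (im (g i j)) => h1 h2.
  by split; rewrite -(@ler_pXn2r _ 2)// ?nnegrE// expr1n real_normK ?num_real//; lra.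
- by move=> i; rewrite divr_gt0.
have := dS; rewrite Sg /congr_rdiag det_congr_rdiag ng mul1r -(rmorph1 iota).
by move/ground_real_inj.
Qed.

Lemma congr_rdiag_Pos g d : g \in unitmx -> (forall i, 0 < d i) ->
  nsq (\det g) * \prod_i d i = 1 -> Pos (congr_rdiag g d).
Proof.
move=> ug d0 dg; split.
- by rewrite /congr_rdiag hermitian_congr// adjmx_rdiag.
- apply: posdefmx_congr; last exact/unitmx_full_col_rank.
  move=> x x0; rewrite mxE.
  have -> : \sum_j (adjmx x *m rdiag k d) 0 j * x j 0 =
      iota (\sum_j d j * nsq (x j 0)).
    rewrite rmorph_sum; apply: eq_bigr => j _.
    by rewrite mul_mx_diag !mxE rmorphM /= -ground_conj_mul mulrCA mulrA.
  rewrite ground_real_gt0 lt_neqAle sumr_ge0 ?andbT => [|j _]; last first.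
    by rewrite mulr_ge0 ?ground_normsq_ge0// ltW.
  rewrite eq_sym; apply: contraNneq x0 => x0; apply/eqP/colP => j; apply/eqP.
  rewrite mxE -ground_normsq_eq0.
  move/eqP: x0; rewrite psumr_eq0 => [/allP/(_ j (mem_index_enum j))|i _].
    by rewrite /= mulf_eq0 gt_eqF.
  by rewrite mulr_ge0 ?ground_normsq_ge0// ltW.
by rewrite det_congr_rdiag dg rmorph1.
Qed.

End gram_product.

(** * Minimization over Pos *)

Section compactness.
Context (R : realType) (k : base_field) (m : nat).
Local Notation F := (ground R k).
Local Notation re := (@ground_re R k).
Local Notation im := (@ground_im R k).
Local Notation iota := (ground_of_real R k).
Local Notation nsq := (@ground_normsq R k).

(** The value 0 over the reals makes the decomposition into real and imaginary parts uniform in the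
    field. *)
Definition ground_i : F :=
  match k return ground R k with RealNumbers => 0 | ComplexNumbers => 'i%C end.

Lemma ground_decomp z : z = iota (re z) + ground_i * iota (im z).
Proof.
rewrite /ground_i /ground_re /ground_im /ground_of_real; case: k z => /= [z|z].
  by rewrite mulr0 addr0.
by rewrite {1}(complexE z).
Qed.

Lemma ground_re_decomp a b : re (iota a + ground_i * iota b) = a.
Proof.
rewrite /ground_i /ground_re /ground_of_real; case: k => /=.
  by rewrite mul0r addr0.
by rewrite !(mul0r, mulr0, subr0, addr0).
Qed.

(** Over the reals the second coordinate is lost, hence an inequality and not an equality. *)
Lemma ground_im_decomp a b : `|im (iota a + ground_i * iota b)| <= `|b|.
Proof.
rewrite /ground_i /ground_im /ground_of_real; case: k => /=.
  by rewrite normr0.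
by rewrite !(mul0r, mulr0, subr0, addr0, add0r, mul1r).
Qed.

(** Coordinates of a pair (g, d): the real parts of g, the imaginary parts of g, and d. They are
    packed into a row vector for the extreme value theorem. *)
Let I := ('I_m * 'I_m + 'I_m * 'I_m + 'I_m)%type.
Let N := #|{: I}|.

Definition coord_mx (v : 'rV[R]_N) : 'M[F]_m := \matrix_(i, j)
  (iota (v 0 (enum_rank (inl (inl (i, j)) : I))) +
   ground_i * iota (v 0 (enum_rank (inl (inr (i, j)) : I)))).

Definition coord_diag (v : 'rV[R]_N) (i : 'I_m) : R := v 0 (enum_rank (inr i : I)).

Definition coord_of (g : 'M[F]_m) (d : 'I_m -> R) : 'rV[R]_N := \row_l
  match (enum_val l : I) with
  | inl (inl (i, j)) => re (g i j)
  | inl (inr (i, j)) => im (g i j)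
  | inr i => d i
  end.

Lemma coord_ofK g d : coord_mx (coord_of g d) = g /\ coord_diag (coord_of g d) = d.
Proof.
split; last by apply/funext => i; rewrite /coord_diag mxE enum_rankK.
by apply/matrixP => i j; rewrite !mxE !enum_rankK -ground_decomp.
Qed.

Definition continuousR (f : 'rV[R]_N -> R) : Prop := continuous f.

Lemma continuousR_cst c : continuousR (fun=> c).
Proof. by move=> v; exact: cst_continuous. Qed.

Lemma continuousR_add f g :
  continuousR f -> continuousR g -> continuousR (fun v => f v + g v).
Proof. by move=> cf cg v; apply: continuousD; [exact: cf|exact: cg]. Qed.

Lemma continuousR_mul f g :
  continuousR f -> continuousR g -> continuousR (fun v => f v * g v).
Proof. by move=> cf cg v; apply: continuousM; [exact: cf|exact: cg]. Qed.

Lemma continuousR_prod J (s : seq J) (f : J -> 'rV[R]_N -> R) :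
  (forall j, continuousR (f j)) -> continuousR (fun v => \prod_(j <- s) f j v).
Proof.
move=> cf; elim: s => [|j s IH].
  rewrite (_ : (fun v => _) = fun=> 1); first exact: continuousR_cst.
  by apply/funext => v; rewrite big_nil.
rewrite (_ : (fun v => _) = fun v => f j v * \prod_(i <- s) f i v).
  exact: continuousR_mul.
by apply/funext => v; rewrite big_cons.
Qed.

Lemma continuousR_sum J (s : seq J) (P : pred J) (f : J -> 'rV[R]_N -> R) :
  (forall j, continuousR (f j)) -> continuousR (fun v => \sum_(j <- s | P j) f j v).
Proof.
move=> cf; elim: s => [|j s IH].
  rewrite (_ : (fun v => _) = fun=> 0); first exact: continuousR_cst.
  by apply/funext => v; rewrite big_nil.
rewrite (_ : (fun v => _) = fun v =>
    (P j)%:R * f j v + \sum_(i <- s | P i) f i v).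
  by apply: continuousR_add => //; apply: continuousR_mul => //; exact: continuousR_cst.
by apply/funext => v; rewrite big_cons; case: (P j); rewrite ?mul1r// mul0r add0r.
Qed.

Lemma continuousR_coord i : continuousR (fun v => v 0 i).
Proof. exact: coord_continuous. Qed.

Lemma continuous_coord_mx : groundfun_mx continuousR coord_mx.
Proof.
have c1 := continuousR_cst; have c2 := continuousR_add; have c3 := continuousR_mul.
move=> i j; apply: (@groundfun_eq R k _ continuousR (fun v : 'rV[R]_N =>
  iota (v 0 (enum_rank (inl (inl (i, j)) : I))) +
   ground_i * iota (v 0 (enum_rank (inl (inr (i, j)) : I))))).
  by move=> v; rewrite mxE.
apply: groundfun_add => //; first by apply: groundfun_real => //; exact: continuousR_coord.
apply: groundfun_mul => //.
by apply: groundfun_real => //; exact: continuousR_coord.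
Qed.

Lemma unitary_box_min (lo hi : R) (f : 'M[F]_m -> ('I_m -> R) -> R)
    (d0 : 'I_m -> R) :
  continuousR (fun v => f (coord_mx v) (coord_diag v)) ->
  (forall i, lo <= d0 i <= hi) -> \prod_i d0 i = 1 ->
  exists (g : 'M[F]_m) (d : 'I_m -> R),
    [/\ unitary_box g, forall i, lo <= d i <= hi, \prod_i d i = 1 &
    forall g' (d' : 'I_m -> R), unitary_box g' -> (forall i, lo <= d' i <= hi) ->
      \prod_i d' i = 1 -> f g d <= f g' d'].
Proof.
move=> cf bd0 pd0.
have c1 := continuousR_cst; have c2 := continuousR_add; have c3 := continuousR_mul.
(* A sum of two squares expresses both constraints, |det g|^2 = 1 and prod d = 1, by a single
   equation. *)
pose h v := (nsq (\det (coord_mx v)) + -1) * (nsq (\det (coord_mx v)) + -1) +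
  (\prod_i coord_diag v i + -1) * (\prod_i coord_diag v i + -1).
have ch : continuousR h.
  have cdet : continuousR (fun v => nsq (\det (coord_mx v)) + -1).
    apply: continuousR_add => //.
    exact: (groundfun_normsq c2 c3 (groundfun_det c1 c2 c3 continuous_coord_mx)).
  have cprod : continuousR (fun v => \prod_i coord_diag v i + -1).
    by apply: continuousR_add => //; apply: continuousR_prod => i; exact: continuousR_coord.
  by apply: continuousR_add; exact: continuousR_mul.
have hP v : h v = 0 -> nsq (\det (coord_mx v)) = 1 /\ \prod_i coord_diag v i = 1.
  rewrite /h -!expr2 => /eqP; rewrite paddr_eq0 ?sqr_ge0// !sqrf_eq0 !subr_eq0.
  by case/andP => /eqP -> /eqP ->.
pose bnd (x y : R) (l : 'I_N) := if (enum_val l : I) is inr _ then y else x.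
have bndP (g : 'M[F]_m) (d : 'I_m -> R) : unitary_box g -> (forall i, lo <= d i <= hi) ->
    \prod_i d i = 1 -> (forall l, bnd (-1) lo l <= coord_of g d 0 l <= bnd 1 hi l) /\
    h (coord_of g d) = 0.
  move=> [bg ng] bd pd; split; last first.
    by rewrite /h; have [-> ->] := coord_ofK g d; rewrite ng pd !subrr mul0r addr0.
  move=> l; rewrite /bnd mxE; case: (enum_val l) => [[[i j]|[i j]]|i] //.
    by rewrite -ler_norml (bg i j).1.
  by rewrite -ler_norml (bg i j).2.
have nonempty : [set v : 'rV[R]_N |
    (forall l, bnd (-1) lo l <= v 0 l <= bnd 1 hi l) /\ h v = 0] !=set0.
  by exists (coord_of 1%:M d0); exact: bndP (unitary_box1 R k m) bd0 pd0.
have [v [bv hv] vmin] := continuous_box_min ch cf nonempty.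
have [dg pd] := hP _ hv.
exists (coord_mx v), (coord_diag v); split=> //.
- split=> // i j; rewrite !mxE.
  have b1 := bv (enum_rank (inl (inl (i, j)) : I)).
  have b2 := bv (enum_rank (inl (inr (i, j)) : I)).
  move: b1 b2; rewrite /bnd !enum_rankK -!ler_norml => b1 b2.
  by rewrite ground_re_decomp; split=> //; exact: le_trans (ground_im_decomp _ _) b2.
- by move=> i; have := bv (enum_rank (inr i : I)); rewrite /bnd enum_rankK.
move=> g d bg bd pd'; have := vmin _ (bndP g d bg bd pd').
by have [-> ->] := coord_ofK g d.
Qed.

End compactness.

(* The defect is a sum of squares, by Lagrange's identity. *)
Lemma cauchy_schwarz_sum (R : realFieldType) (I : finType) (u v : I -> R) :
  (\sum_i u i * v i) ^+ 2 <= (\sum_i u i ^+ 2) * (\sum_i v i ^+ 2) /\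
  ((\sum_i u i ^+ 2) * (\sum_i v i ^+ 2) <= (\sum_i u i * v i) ^+ 2 ->
    forall i j, u i * v j = u j * v i).
Proof.
have E : \sum_i \sum_j (u i * v j - u j * v i) ^+ 2 =
    2 * ((\sum_i u i ^+ 2) * (\sum_i v i ^+ 2) - (\sum_i u i * v i) ^+ 2).
  transitivity (\sum_i \sum_j (u i ^+ 2 * v j ^+ 2) + \sum_i \sum_j (v i ^+ 2 * u j ^+ 2)
      + \sum_i \sum_j (- 2 * ((u i * v i) * (u j * v j)))).
    rewrite -!big_split/=; apply: eq_bigr => i _.
    by rewrite -!big_split/=; apply: eq_bigr => j _; ring.
  have P (f g : I -> R) : \sum_i \sum_j f i * g j = (\sum_i f i) * (\sum_j g j).
    by rewrite mulr_suml; apply: eq_bigr => i _; rewrite mulr_sumr.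
  rewrite !P; under [X in _ + X]eq_bigr do rewrite -mulr_sumr.
  by rewrite -mulr_sumr P; ring.
have sq i j : 0 <= (u i * v j - u j * v i) ^+ 2 := sqr_ge0 _.
split.
  have : 0 <= \sum_i \sum_j (u i * v j - u j * v i) ^+ 2.
    by apply: sumr_ge0 => i _; exact: sumr_ge0.
  by rewrite E pmulr_rge0// subr_ge0.
move=> le i j; have /eqP : \sum_i \sum_j (u i * v j - u j * v i) ^+ 2 = 0.
  apply/eqP; rewrite eq_le; apply/andP; split.
    by rewrite E pmulr_rle0// subr_le0.
  by apply: sumr_ge0 => i' _; exact: sumr_ge0.
rewrite psumr_eq0 => [/allP/(_ i (mem_index_enum i))/=|i' _]; last exact: sumr_ge0.
rewrite psumr_eq0// => /allP/(_ j (mem_index_enum j))/=.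
by rewrite sqrf_eq0 subr_eq0 => /eqP.
Qed.

(** One strict inequality between positive factors would make the products differ. This passes from
    equality of products to equality of factors. *)
Lemma prod_le_eq (R : realFieldType) (I : finType) (x y : I -> R) :
  (forall i, 0 < x i) -> (forall i, x i <= y i) -> \prod_i y i <= \prod_i x i ->
  forall i, x i = y i.
Proof.
move=> x0 xy le i; apply/eqP; rewrite eq_le xy /= leNgt; apply/negP => lt.
move: le; apply/negP; rewrite -ltNge (bigD1 i)//= [X in _ < X](bigD1 i)//=.
have P0 : 0 < \prod_(j | j != i) x j by exact: prodr_gt0.
apply: (@lt_le_trans _ _ (y i * \prod_(j | j != i) x j)); first by rewrite ltr_pM2r.
rewrite ler_pM2l ?(lt_trans (x0 i))//; apply: ler_prod => j _.
by rewrite ltW//= xy.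
Qed.

(** * Existence and uniqueness of the minimizer *)

Section gram_minimum.
Context (R : realType) (k : base_field).
Local Notation F := (ground R k).
Local Notation re := (@ground_re R k).
Local Notation nsq := (@ground_normsq R k).
Context (m r n : nat) (X : 'I_n -> 'M[F]_(m, r)).
Hypothesis m_gt0 : (0 < m)%N.
Hypothesis X_stable : stable X.
Hypothesis X_full : forall k, full_col_rank (X k).

Local Notation rows := {ffun 'I_n -> {ffun 'I_r -> 'I_m}}.

Definition minors_sum (s : {set rows}) (g : 'M[F]_m) : R :=
  \sum_(f in s) \prod_k nsq (\det (rowsub (f k) (g *m X k))).

Let ones : 'I_m -> R := fun=> 1.

(** A positive continuous function has a positive minimum on the compact set of matrices. Placing
    positivity inside the claim provides a constant for every set [s], before it is known which one
    is relevant. *)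
Lemma minors_sum_inf (s : {set rows}) : exists c, 0 < c /\
  ((forall g, unitary_box g -> 0 < minors_sum s g) ->
   forall g, unitary_box g -> c <= minors_sum s g).
Proof.
have c1 := @continuousR_cst R m; have c2 := @continuousR_add R m.
have c3 := @continuousR_mul R m.
have [pos|npos] := pselect (forall g, unitary_box g -> 0 < minors_sum s g); last first.
  by exists 1; split.
have cf : continuousR (fun v => minors_sum s (coord_mx k v)).
  apply: continuousR_sum => f; apply: continuousR_prod => l.
  apply: (groundfun_normsq c2 c3); apply: groundfun_det => // i j.
  apply: (@groundfun_eq R k _ (@continuousR R m) (fun v =>
    (coord_mx k v *m X l) (f l i) j)).
    by move=> v; rewrite [RHS]mxE.
  have cX : groundfun_mx (@continuousR R m) (fun=> X l).
    by move=> a b; split; exact: c1.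
  have cM := @continuous_coord_mx R k m.
  exact: (groundfun_mulmx c1 c2 c3 cM cX (f l i) j).
(* Only g varies here: the diagonal coordinates are confined to the value 1. *)
have bd i : 1 <= ones i <= 1 by rewrite lexx.
have pd : \prod_i ones i = 1 by rewrite big1.
have [g [d [bg _ _ gmin]]] :=
  unitary_box_min (f := fun g _ => minors_sum s g) cf bd pd.
exists (minors_sum s g); split; first exact: pos.
by move=> _ g' bg'; exact: gmin bg' bd pd.
Qed.

(** In the Cauchy-Binet expansion, keep the tuples of minors satisfying the weight inequality for a
    = ln d. Each has weight at least exp((a p - a q) / m), and by stability their squared moduli
    have a positive sum at every [g] in the box. *)
Lemma gram_prod_coercive : exists c, 0 < c /\ forall g (d : 'I_m -> R),
  unitary_box g -> (forall i, 0 < d i) -> \prod_i d i = 1 ->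
  forall p q, c * expR ((ln (d p) - ln (d q)) / m%:R) <= gram_prod X (congr_rdiag g d).
Proof.
have /choice[cs csP] := minors_sum_inf.
(* The set of retained tuples depends on d; minimizing over the finitely many sets makes the
   constant uniform in d. *)
pose s0 := [arg min_(s < (finset.set0 : {set rows})) cs s]%O.
have s0P s : cs s0 <= cs s by rewrite /s0; case: arg_minP => // s' _; apply.
exists ((r`!%:R^-1) ^+ n * cs s0); split.
  by rewrite mulr_gt0 ?exprn_gt0 ?invr_gt0 ?ltr0n ?fact_gt0//; exact: (csP s0).1.
move=> g d bg d0 pd p q; pose a i := ln (d i).
have suma : \sum_i a i = 0.
  rewrite -[LHS]expRK expR_sum -[RHS]ln1 -[X in _ = ln X]pd; congr ln.
  by apply: eq_bigr => i _; rewrite lnK// posrE.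
pose good : {set rows} := finset (fun f : rows => [forall p, forall q,
  (n * r)%:R * \sum_l a l + (a p - a q) <= m%:R * \sum_k \sum_i a (f k i)]).
have good_pos g' : unitary_box g' -> 0 < minors_sum good g'.
  move=> bg'; have [f [fdet fw]] := stable_weights a X_stable
    (fun l => full_col_rank_row_full (@X_full l)) (unitary_box_unit bg').
  pose f' : rows := [ffun l => f l]; have fE l : f' l = f l by rewrite ffunE.
  have fgood : f' \in good.
    rewrite inE; apply/forallP => p'; apply/forallP => q'.
    by move: (fw p' q'); congr (_ <= _ * _); apply: eq_bigr => l _; rewrite fE.
  rewrite /minors_sum (bigD1 f')//= ltr_pwDl//.
    by apply: prodr_gt0 => l _; rewrite fE ground_normsq_gt0.
  by apply: sumr_ge0 => f'' _; apply: prodr_ge0 => l _; exact: ground_normsq_ge0.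
have cgood := (csP good).2 good_pos g bg.
have E : gram_prod X (congr_rdiag g d) = (r`!%:R^-1) ^+ n *
    \sum_(f : rows) (\prod_k \prod_i d (f k i)) *
      \prod_k nsq (\det (rowsub (f k) (g *m X k))).
  rewrite /gram_prod; under eq_bigr do rewrite det_gram_congr.
  rewrite big_split /= prodr_const card_ord; congr (_ * _).
  rewrite /weighted_minors bigA_distr_bigA /=; apply: eq_bigr => f _.
  by rewrite big_split.
rewrite E -mulrA ler_pM2l ?exprn_gt0 ?invr_gt0 ?ltr0n ?fact_gt0//.
have term_ge0 (f : rows) : 0 <= (\prod_k \prod_i d (f k i)) *
    \prod_k nsq (\det (rowsub (f k) (g *m X k))).
  apply: mulr_ge0; last by apply: prodr_ge0 => l _; exact: ground_normsq_ge0.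
  by apply: prodr_ge0 => l _; apply: prodr_ge0 => i _; exact: ltW.
apply: (@le_trans _ _ (expR ((a p - a q) / m%:R) * minors_sum good g)).
  by rewrite mulrC ler_pM2l ?expR_gt0// (le_trans (s0P good)).
rewrite [leRHS](bigID (mem good))/= -[leLHS]addr0 lerD//; last exact: sumr_ge0.
rewrite /minors_sum mulr_sumr; apply: ler_sum => f; rewrite inE => /forallP/(_ p)/forallP/(_ q).
rewrite suma mulr0 add0r => fpq; apply: ler_wpM2r.
  by apply: prodr_ge0 => l _; exact: ground_normsq_ge0.
have -> : \prod_k \prod_i d (f k i) = expR (\sum_k \sum_i a (f k i)).
  rewrite expR_sum; apply: eq_bigr => l _; rewrite expR_sum; apply: eq_bigr => i _.
  by rewrite lnK// posrE.
by rewrite ler_expR ler_pdivrMr ?ltr0n// mulrC.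
Qed.

(** Coercivity confines every S that does at least as well as the identity to a compact box, where
    the continuous function has a minimum. *)
Lemma gram_prod_min_exists :
  exists S, Pos S /\ forall S', Pos S' -> gram_prod X S <= gram_prod X S'.
Proof.
have [c [c0 cP]] := gram_prod_coercive.
have pd : \prod_i ones i = 1 by rewrite big1.
pose C1 := gram_prod X (congr_rdiag 1%:M ones).
have p0 : 'I_m by exact: Ordinal m_gt0.
have cC1 : c <= C1.
  have := cP 1%:M ones (unitary_box1 R k m) (fun=> ltr01) pd p0 p0.
  by rewrite subrr mul0r expR0 mulr1.
have C1_gt0 : 0 < C1 by exact: lt_le_trans cC1.
(* By coercivity, a value at most [C1] forces ln (d p) - ln (d q) <= b for all p and q. *)
pose b := m%:R * ln (C1 / c).
have b0 : 0 <= b by rewrite mulr_ge0// ln_ge0// ler_pdivlMr// mul1r.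
have cf : continuousR (fun v : 'rV[R]__ =>
    gram_prod X (congr_rdiag (coord_mx k v) (coord_diag v))).
  have c1 := @continuousR_cst R m; have c2 := @continuousR_add R m.
  have c3 := @continuousR_mul R m; have cM := @continuous_coord_mx R k m.
  have cX l : groundfun_mx (@continuousR R m) (fun=> X l).
    by move=> i j; split; exact: c1.
  have cD : groundfun_mx (@continuousR R m) (fun v => rdiag k (coord_diag v)).
    move=> i j; apply: (@groundfun_eq R k _ (@continuousR R m) (fun v =>
        ground_of_real R k (coord_diag v i) * (i == j)%:R)).
      by move=> v; rewrite !mxE mulr_natr.
    apply: (groundfun_mul c1 c2 c3); last by split; exact: c1.
    have ci : continuousR (fun v : 'rV[R]__ => coord_diag (m := m) v i).
      exact: continuousR_coord.
    exact: (groundfun_real k c1 ci).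
  apply: continuousR_prod => l.
  suff [] : groundfun (@continuousR R m) (fun v =>
    \det (adjmx (X l) *m congr_rdiag (coord_mx k v) (coord_diag v) *m X l)) by [].
  apply: (groundfun_det c1 c2 c3).
  apply: (groundfun_mulmx c1 c2 c3) => //.
  apply: (groundfun_mulmx c1 c2 c3) (groundfun_adjmx c1 c3 (cX l)) _.
  apply: (groundfun_mulmx c1 c2 c3) => //.
  exact: (groundfun_mulmx c1 c2 c3 (groundfun_adjmx c1 c3 cM) cD).
have bd i : expR (- b) <= ones i <= expR b.
  by rewrite -[ones i]expR0 !ler_expR b0 oppr_le0 b0.
have [g [d [bg bdd pdd gmin]]] :=
  unitary_box_min (f := fun g d => gram_prod X (congr_rdiag g d)) cf bd pd.
exists (congr_rdiag g d); split.
  apply: congr_rdiag_Pos; first exact: unitary_box_unit bg.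
    by move=> i; have /andP[+ _] := bdd i; apply: lt_le_trans; exact: expR_gt0.
  by rewrite bg.2 pdd mul1r.
move=> S' /Pos_congr_rdiag[g' [d' [bg' d'0 pd' ->]]].
have [le1|/ltW lt1] := leP (gram_prod X (congr_rdiag g' d')) C1; last first.
  by apply: le_trans lt1; exact: gmin (unitary_box1 R k m) bd pd.
apply: gmin => //.
have lnle p q : ln (d' p) - ln (d' q) <= b.
  have := le_trans (cP g' d' bg' d'0 pd' p q) le1.
  rewrite mulrC -ler_pdivlMr// -[X in _ <= X]lnK ?posrE ?divr_gt0// ler_expR.
  by rewrite ler_pdivrMr ?ltr0n// mulrC.
have suml : \sum_i ln (d' i) = 0.
  rewrite -[LHS]expRK expR_sum -[RHS]ln1 -[X in _ = ln X]pd'; congr ln.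
  by apply: eq_bigr => i _; rewrite lnK// posrE.
move=> i; rewrite -[d' i]lnK ?posrE// !ler_expR.
have m0 : (0 : R) < m%:R by rewrite ltr0n.
(* The logarithms sum to 0, so each of them is the mean of its differences to all of them, and these
   are at most [b]. *)
have E1 : m%:R * ln (d' i) <= m%:R * b.
  have -> : m%:R * ln (d' i) = \sum_q (ln (d' i) - ln (d' q)).
    by rewrite sumrB suml subr0 sumr_const card_ord mulr_natl.
  by rewrite mulr_natl -[X in _ *+ X]card_ord -sumr_const; apply: ler_sum => q _.
have E2 : m%:R * - ln (d' i) <= m%:R * b.
  have -> : m%:R * - ln (d' i) = \sum_q (ln (d' q) - ln (d' i)).
    by rewrite sumrB suml sub0r sumr_const card_ord mulr_natl mulNrn.
  by rewrite mulr_natl -[X in _ *+ X]card_ord -sumr_const; apply: ler_sum => q _.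
by move: E1 E2; rewrite !ler_pM2l// => -> E2; rewrite lerNl E2.
Qed.

(** Cauchy-Schwarz for the vectors whose entries are the products of s, respectively t, times the
    moduli of the minors. In the equality case these vectors are proportional. *)
Lemma weighted_minors_cauchy_schwarz (Y : 'M[F]_(m, r)) (s t : 'I_m -> R) :
  let W := weighted_minors Y in
  W (fun i => s i * t i) ^+ 2 <= W (fun i => s i ^+ 2) * W (fun i => t i ^+ 2) /\
  (W (fun i => s i ^+ 2) * W (fun i => t i ^+ 2) <= W (fun i => s i * t i) ^+ 2 ->
   forall f g : {ffun 'I_r -> 'I_m},
     \det (rowsub f Y) != 0 -> \det (rowsub g Y) != 0 ->
     (\prod_i s (f i)) * (\prod_i t (g i)) = (\prod_i s (g i)) * (\prod_i t (f i))).
Proof.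
move=> W.
pose w (f : {ffun 'I_r -> 'I_m}) := Num.sqrt (nsq (\det (rowsub f Y))).
pose u (d : 'I_m -> R) (f : {ffun 'I_r -> 'I_m}) := (\prod_i d (f i)) * w f.
have w2 f : w f ^+ 2 = nsq (\det (rowsub f Y)) by rewrite sqr_sqrtr// ground_normsq_ge0.
have W2 d : W (fun i => d i ^+ 2) = \sum_f u d f ^+ 2.
  by apply: eq_bigr => f _; rewrite prodrXl /u exprMn w2.
have Wst : W (fun i => s i * t i) = \sum_f u s f * u t f.
  by apply: eq_bigr => f _; rewrite big_split /= /u mulrACA -expr2 w2.
have [le eq] := cauchy_schwarz_sum (u s) (u t).
rewrite !W2 Wst; split=> // /eq + f g; move=> /(_ f g) E.
move=> df dg.
have wf : 0 < w f by rewrite sqrtr_gt0 ground_normsq_gt0.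
have wg : 0 < w g by rewrite sqrtr_gt0 ground_normsq_gt0.
apply: (mulIf (lt0r_neq0 (mulr_gt0 wf wg))).
by rewrite mulrACA -!/(u _ _) E /u mulrACA [w g * w f]mulrC.
Qed.

Lemma gram_prod_min_unique (S S' : 'M[F]_m) : Pos S -> Pos S' ->
  (forall T, Pos T -> gram_prod X S <= gram_prod X T) ->
  (forall T, Pos T -> gram_prod X S' <= gram_prod X T) -> S = S'.
Proof.
move=> PS PS' minS minS'; have [hS pS dS] := PS; have [hS' pS' dS'] := PS'.
have [h [d0 [d1 [uh ES ES']]]] := simultaneous_diag hS hS' pS.
have d0_gt0 : forall i, 0 < d0 i by apply: (congr_rdiag_gt0 uh); rewrite -[congr_rdiag _ _]ES.
have d1_gt0 : forall i, 0 < d1 i by apply: (congr_rdiag_gt0 uh); rewrite -[congr_rdiag _ _]ES'.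
have [s s0 sE] : exists2 s : 'I_m -> R, forall i, 0 < s i & d0 = (fun i => s i ^+ 2).
  exists (fun i => Num.sqrt (d0 i)) => [i|]; first by rewrite sqrtr_gt0.
  by apply/funext => i; rewrite sqr_sqrtr// ltW.
have [t t0 tE] : exists2 t : 'I_m -> R, forall i, 0 < t i & d1 = (fun i => t i ^+ 2).
  exists (fun i => Num.sqrt (d1 i)) => [i|]; first by rewrite sqrtr_gt0.
  by apply/funext => i; rewrite sqr_sqrtr// ltW.
have N0 : nsq (\det h) * (\prod_i s i) ^+ 2 = 1.
  apply: (@ground_real_inj R k); rewrite -prodrXl -det_congr_rdiag.
  by move: dS; rewrite ES sE => ->; rewrite rmorph1.
have N1 : nsq (\det h) * (\prod_i t i) ^+ 2 = 1.
  apply: (@ground_real_inj R k); rewrite -prodrXl -det_congr_rdiag.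
  by move: dS'; rewrite ES' tE => ->; rewrite rmorph1.
have st : \prod_i s i = \prod_i t i.
  have n0 : nsq (\det h) != 0.
    by rewrite ground_normsq_eq0 -unitfE -unitmxE.
  have := mulfI n0 (etrans N0 (esym N1)) => /eqP.
  by rewrite eqrXn2 ?prodr_ge0// => [/eqP//|i _|i _]; exact: ltW.
pose a i := ln (t i) - ln (s i).
have ln_prod_pos (J : finType) (q : J -> R) : (forall j, 0 < q j) ->
    ln (\prod_j q j) = \sum_j ln (q j).
  move=> q0; rewrite -[RHS]expRK expR_sum; congr ln.
  by apply: eq_bigr => j _; rewrite lnK// posrE.
have suma : \sum_i a i = 0.
  by rewrite sumrB -!ln_prod_pos// st subrr.
(* The midpoint of [S] and [S']: in the common diagonalization the entries are the geometric means
   of [d0] and [d1]. *)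
pose T := congr_rdiag h (fun i => s i * t i).
have PT : Pos T.
  apply: congr_rdiag_Pos => //; first by move=> i; rewrite mulr_gt0.
  by rewrite big_split /= -st -expr2.
have rf0 : (r`!%:R^-1 : R) > 0 by rewrite invr_gt0 ltr0n fact_gt0.
pose W l d := re (\det (adjmx (X l) *m congr_rdiag h d *m X l)).
have WE l d : W l d = r`!%:R^-1 * weighted_minors (h *m X l) d by exact: det_gram_congr.
have Wpos l d : (forall i, 0 < d i) -> 0 < W l d.
  by move=> dpos; exact: det_gram_congr_gt0.
have CS l := weighted_minors_cauchy_schwarz (h *m X l) s t.
(* Each factor satisfies Cauchy-Schwarz, while minimality of [S] and [S'] against [T] gives the
   opposite inequality for the products; so every factor is an equality. *)
have Weq : forall l, W l (fun i => s i * t i) ^+ 2 = W l d0 * W l d1.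
  apply: prod_le_eq => [l|l|].
  - by rewrite exprn_gt0// Wpos// => i; rewrite mulr_gt0.
  - rewrite !WE exprMn [leRHS]mulrACA -[r`!%:R^-1 * r`!%:R^-1]expr2 sE tE.
    rewrite ler_pM2l ?exprn_gt0//.
    exact: (CS l).1.
  rewrite big_split prodrXl /= expr2.
  have -> : \prod_l W l d0 = gram_prod X S by rewrite ES.
  have -> : \prod_l W l d1 = gram_prod X S' by rewrite ES'.
  have P0 d : (forall i, 0 < d i) -> 0 <= gram_prod X (congr_rdiag h d).
    by move=> dpos; apply: prodr_ge0 => l _; apply/ltW/Wpos.
  apply: ler_pM; [by rewrite ES; exact: P0|by rewrite ES'; exact: P0|exact: minS|exact: minS'].
(* The equality case says that all nonzero minors of h X_l have the same total weight for a = ln(t /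
   s). *)
have const l (f g : {ffun 'I_r -> 'I_m}) : \det (rowsub f (h *m X l)) != 0 ->
    \det (rowsub g (h *m X l)) != 0 -> \sum_i a (f i) = \sum_i a (g i).
  move=> ff gg; have := (CS l).2; rewrite -sE -tE => /(_ _ f g ff gg) E.
  have {}E : (\prod_i s (f i)) * (\prod_i t (g i)) = (\prod_i s (g i)) * (\prod_i t (f i)).
    apply: E; have := Weq l; rewrite !WE exprMn [RHS]mulrACA -[r`!%:R^-1 * r`!%:R^-1]expr2.
    by move=> /(mulfI (lt0r_neq0 (exprn_gt0 2 rf0))) ->.
  rewrite !sumrB -!ln_prod_pos//; move/(congr1 (@ln R)): E.
  by rewrite !lnM ?posrE ?prodr_gt0//; lra.
have fullX l := full_col_rank_row_full (@X_full l).
have [f [f0 fw]] := stable_weights a X_stable fullX uh.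
have [g [g0 gw]] := stable_weights (fun i => - a i) X_stable fullX uh.
(* By [const], the choices [f] and [g] have the same total weight w. The two weight inequalities
   give a p - a q <= m w and a p - a q <= - m w. *)
have ale p q : a p <= a q.
  have := fw p q; have := gw q p; rewrite sumrN suma oppr0 mulr0 !add0r.
  have -> : \sum_l \sum_i - a (g l i) = - \sum_l \sum_i a (f l i).
    rewrite -sumrN; apply: eq_bigr => l _; rewrite sumrN; congr (- _).
    exact: const.
  rewrite mulrN; lra.
have a0 i : a i = 0.
  have : \sum_j a j = m%:R * a i.
    rewrite mulr_natl -[X in _ *+ X]card_ord -sumr_const; apply: eq_bigr => j _.
    by apply/eqP; rewrite eq_le !ale.
  rewrite suma => /esym/eqP; rewrite mulf_eq0 pnatr_eq0 eqn0Ngt m_gt0 /=.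
  by move/eqP.
rewrite ES ES' sE tE; congr (_ *m rdiag k _ *m _); apply/funext => i.
have /eqP := a0 i; rewrite subr_eq0 => /eqP/ln_inj.
by rewrite !posrE => ->.
Qed.

End gram_minimum.

(** * From minimizers to maximum likelihood estimates *)

Section estimate.
Context (R : realType) (k : base_field) (m r : nat) (rm : (r < m)%N).
Local Notation F := (ground R k).
Local Notation re := (@ground_re R k).
Local Notation iota := (ground_of_real R k).
Local Notation V := 'cV[F]_m.
Local Notation Gr := (grassmannian R k rm).

Lemma Pos_invmx (S : 'M[F]_m) : Pos S -> Pos (invmx S).
Proof.
move=> [hS pS dS]; have uS : S \in unitmx by rewrite unitmxE dS unitr1.
have hV : adjmx (invmx S) = invmx S.
  apply: (row_free_inj (A := S)); first by rewrite row_free_unit.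
  by rewrite mulVmx// -{2}hS -adjmxM mulmxV// adjmx1.
split=> //; last by rewrite det_inv dS invr1.
rewrite -[invmx S](mulmxK uS) -{1}hV; apply: posdefmx_congr => //.
by apply/unitmx_full_col_rank; rewrite unitmx_inv.
Qed.

Lemma det_gram_real (Y : 'M[F]_(m, r)) (S : 'M[F]_m) : Pos S ->
  \det (adjmx Y *m S *m Y) = iota (re (\det (adjmx Y *m S *m Y))).
Proof.
move=> [hS _ _]; apply: ground_realP.
by rewrite -det_adjmx hermitian_congr.
Qed.

Lemma det_gram_gt0 (Y : 'M[F]_(m, r)) (S : 'M[F]_m) : Pos S ->
  full_col_rank Y -> 0 < re (\det (adjmx Y *m S *m Y)).
Proof.
move=> /Pos_congr_rdiag[g [d [bg d0 _ ->]]] fY.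
by apply: det_gram_congr_gt0 => //; exact: unitary_box_unit bg.
Qed.

Lemma Pos1 : Pos (1%:M : 'M[F]_m).
Proof.
have -> : 1%:M = congr_rdiag 1%:M (fun=> 1) :> 'M[F]_m.
  by rewrite /congr_rdiag rdiag1 !mulmx1 adjmx1.
apply: congr_rdiag_Pos => //; first exact: unitmx1.
by rewrite big1// mulr1; have [_ ->] := unitary_box1 R k m.
Qed.

Context (n : nat) (u : n.-tuple Gr) (X : 'I_n -> 'M[F]_(m, r)).
Hypothesis uX : forall l, limg (linfun (mulmx (X l) : 'cV_r -> V)) = val (tnth u l).

Lemma frames_full l : full_col_rank (X l).
Proof. by have [] := gr_proj_frame (uX l). Qed.

(** The log-likelihood is a decreasing affine function of the logarithm of the Gram product at the
    inverse matrix. Positivity of the Gram determinants allows taking logarithms factor by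
    factor. *)
Lemma log_likelihood_gram_prod (S : 'M[F]_m) : Pos S ->
  log_likelihood u S = n%:R^-1 * ((real_dim k * m)%:R / 2 *
    (ln (gram_prod X 1%:M) - ln (gram_prod X (invmx S)))).
Proof.
move=> PS; rewrite /log_likelihood; congr (_ * _).
have PV := Pos_invmx PS.
have lnprod T : Pos T -> ln (gram_prod X T) =
    \sum_l ln (re (\det (adjmx (X l) *m T *m X l))).
  move=> PT; rewrite -[RHS]expRK expR_sum; congr ln.
  apply: eq_bigr => l _; rewrite lnK// posrE; apply: det_gram_gt0 => //.
  exact: frames_full.
rewrite (lnprod _ Pos1) (lnprod _ PV) -sumrB mulr_sumr; apply: eq_bigr => l _.
rewrite (grassmannian_densityE _ (uX l)) ln_powR; congr (_ * _).
have fl := @frames_full l; have c0 := det_gram_gt0 Pos1 fl; have w0 := det_gram_gt0 PV fl.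
have E : adjmx (X l) *m X l = adjmx (X l) *m 1%:M *m X l by rewrite mulmx1.
rewrite {1}E (det_gram_real _ Pos1) (det_gram_real _ PV) -fmorphV -rmorphM ground_re_real.
by rewrite !ground_re_real ln_div.
Qed.

(** Inversion is a bijection of [Pos] that exchanges minimizers of the Gram product and maximizers
    of the likelihood. *)
Lemma stable_unique_GE : (0 < n)%N -> stable X -> exists! S, is_GE u S.
Proof.
move=> n0 sX; have m0 : (0 < m)%N by exact: leq_ltn_trans rm.
have fX := frames_full.
have c0 : 0 < (n%:R^-1 : R) by rewrite invr_gt0 ltr0n.
have p0 : 0 < ((real_dim k * m)%:R / 2 : R).
  by rewrite divr_gt0// ltr0n muln_gt0 m0 real_dim_gt0.
have gp T : Pos T -> 0 < gram_prod X T.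
  by move=> PT; apply: prodr_gt0 => l _; apply: det_gram_gt0 => //; exact: fX.
have le S T : Pos S -> Pos T -> (log_likelihood u T <= log_likelihood u S) =
    (gram_prod X (invmx S) <= gram_prod X (invmx T)).
  move=> PS PT; rewrite !log_likelihood_gram_prod// ler_pM2l// ler_pM2l//.
  by rewrite lerD2l lerN2 ler_ln// posrE gp//; exact: Pos_invmx.
have [S [PS minS]] := gram_prod_min_exists m0 sX fX.
exists (invmx S); split.
  split; first exact: Pos_invmx.
  move=> T PT; rewrite le//; last exact: Pos_invmx.
  by rewrite invmxK; apply: minS; exact: Pos_invmx.
move=> T [PT maxT]; apply: (can_inj (@invmxK _ _)); rewrite invmxK.
apply: (gram_prod_min_unique m0 sX fX) => //; first exact: Pos_invmx.
move=> Q PQ; have := maxT _ (Pos_invmx PQ).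
by rewrite (le T _ PT (Pos_invmx PQ)) invmxK.
Qed.

End estimate.

(** Multiplication on the right cannot increase the ranks of A X_k. So stability of any vectors
    taken in the subspaces gives stability of frames. *)
Lemma stable_mulmx (F : numFieldType) n m r (X : 'I_n -> 'M[F]_(m, r)) (H : 'I_n -> 'M[F]_r) :
  stable (fun l => X l *m H l) -> stable X.
Proof.
move=> sXH A rA; apply: leq_trans (sXH A rA) _; rewrite leq_mul2l; apply/orP; right.
by apply: leq_sum => l _; rewrite mulmxA mxrankM_maxl.
Qed.

Theorem theorem3 (R : realType) (k : base_field) (m r : nat)
    (r_gt0 : (0 < r)%N) (r_lt_m : (r < m)%N) (n : nat)
    (n_gt : (m ^ 2)%:R / (r * (m - r))%:R < n%:R :> rat) :
  {ae power_prob (grassmannian_uniform R k r_lt_m) n,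
    forall u : n.-tuple (grassmannian R k r_lt_m),
      exists! S : 'M[ground R k]_m, is_GE u S}.
Proof.
have mn : (m ^ 2 < n * (r * (m - r)))%N.
  rewrite -(ltr_nat rat) [X in _ < X]natrM -ltr_pdivrMr//.
  by rewrite ltr0n muln_gt0 r_gt0 subn_gt0.
have n0 : (0 < n)%N by case: (n) mn.
have [e [P [pP P0 PU]]] := unstable_polyfun (ground R k) r_lt_m r_gt0 mn.
have [mh nullP] := poly_null_power n (poly_null_grassmannian R k r_lt_m).
have mZ := measurable_poly_zeros mh pP.
exists [set t | forall g, P (fun i => gr_points (tnth g i.1) (tnth t i.1) i.2) = 0].
split; [exact: mZ|exact: nullP pP P0|].
move=> u /= nGE g.
have /choice[X uX] : forall l, exists X : 'M[ground R k]_(m, r),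
    limg (linfun (mulmx X : 'cV_r -> 'cV[ground R k]_m)) = val (tnth u l).
  by move=> l; exact: exists_frame.
pose Y l : 'M[ground R k]_(m, r) := gr_proj (tnth u l) *m map_mx (fun n => n%:R) (tnth g l).
(* If the projected points [Y] were stable, so would be the frames [X], and a unique estimate would
   exist; hence [Y] is unstable and P vanishes there. *)
rewrite (_ : (fun i => _) = fun x => Y x.1 x.2.1 x.2.2)//; apply: PU => sY.
apply: nGE; apply: (stable_unique_GE uX n0).
(* The coefficients of the projected points in the frame: Y_l = X_l H_l. *)
pose H l := invmx (adjmx (X l) *m X l) *m adjmx (X l) *m map_mx (fun n => n%:R) (tnth g l).
apply: (stable_mulmx (H := H)); move: sY; congr stable; apply/funext => l.
by have [_ pE] := gr_proj_frame (uX l); rewrite /Y /H pE !mulmxA.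
Qed.
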